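(* Let $S$ be a 3-divisible closed and compact surface. Let $\bar S=S$ if $S$ is orientable, and let $\bar S$ be the orientable 2-fold cover of $S$ (with the lifted triangulation) if $S$ is not orientable. Then $S$ has a 2-circuit decomposition if and only if $\theta(\bar S)=0$ in $H^1(\bar S,\mathbb Z_3)$.
   Context: Surface: a connected closed compact surface with a fixed triangulation, i.e. a finite simplicial complex whose realization is a connected closed compact 2-manifold. $S$ is 3-divisible if for every vertex $v$ the number $\mathrm{val}(v)$ of triangles (2-simplices) containing $v$ is divisible by 3. 2-circuit: a cyclic sequence of vertices $v_1\dots v_n$ such that, with indices modulo $n$, every three adjacent terms $\{v_i,v_{i+1},v_{i+2}\}$ form a 2-simplex, and each such 2-simplex arises exactly once among the $n$ windows $i=1,\dots,n$. A 2-circuit decomposition of $S$ is a collection of 2-circuits such that each 2-simplex of $S$ occurs in exactly one of these circuits. The obstruction $\theta(\bar S)$: $\bar S$ is orientable and 3-divisible; fix an orientation of $\bar S$, which induces a local orientation at each vertex $v$, i.e. a direction of travel around the circle $\mathrm{lk}(v)$ (the link of $v$), called the clockwise direction. If $e_1=[u,v]$, $e_2=[v,w]$ are oriented edges, the angle $\theta(e_1e_2)$ is the number of edges of $\mathrm{lk}(v)$ encountered when traveling in $\mathrm{lk}(v)$ from $w$ to $u$ in clockwise direction (so it is $0$ if $u=w$). For a closed edge path $p=e_1e_2\ldots e_n$ put $\theta(p)=\sum_{i=1}^n\theta(e_ie_{i+1})$ with $e_{n+1}=e_1$ (and $\theta(p)=0$ for the empty path). The assignment $[p]\mapsto\theta(p)\bmod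 3$ is a group homomorphism $\pi_1(\bar S,v_0)\to\mathbb Z_3$ (with $\pi_1$ the edge-path group, i.e. the fundamental group); it factors through $H_1(\bar S)$, and $\theta(\bar S)\in H^1(\bar S,\mathbb Z_3)$ is the class corresponding to it under the universal coefficient isomorphism $H^1(\bar S,\mathbb Z_3)\cong\mathrm{Hom}(H_1(\bar S),\mathbb Z_3)$. Whether it vanishes does not depend on the chosen orientation. *)

(* Defs.v *)
From HB Require Import structures.
From mathcomp Require Import all_boot all_order all_algebra.
From Stdlib Require Import ClassicalEpsilon.

Set Implicit Arguments.
Unset Strict Implicit.
Unset Printing Implicit Defensive.

Import GRing.Theory.
Local Open Scope ring_scope.

(** * Triangulated closed surfaces *)

Section Complexes.
Variable V : finType.
Implicit Types (K : {set {set V}}) (u v w : V).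

Definition simplicial_complex K : Prop :=
  set0 \notin K /\
  forall s t : {set V}, t \in K -> s \subset t -> s != set0 -> s \in K.

Definition vertices K : {set V} := [set v | [set v] \in K].

Definition edge K : rel V := fun u v => (u != v) && ([set u; v] \in K).

Definition triangles K : {set {set V}} := [set t in K | #|t| == 3%N].

(* The realization of a complex is connected iff its 1-skeleton is. *)
Definition connected_complex K : Prop :=
  K != set0 /\ {in vertices K &, forall u v, connect (edge K) u v}.

Definition link K v : {set {set V}} :=
  [set t in K | (v \notin t) && (v |: t \in K)].

(* A triangulated circle: a connected 1-dimensional complex each of whose
   vertices lies on exactly two edges. *)
Definition circle K : Prop :=
  [/\ simplicial_complex K, connected_complex K,
      {in K, forall t : {set V}, #|t| <= 2}%N &
      {in vertices K, forall v,
         #|[set t in K | (#|t| == 2%N) && (v \in t)]| = 2%N}].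

(* A triangulation, with vertex set V, of a connected closed compact
   2-manifold.  The realization is such a manifold iff it is connected and all
   the vertex links are circles; in particular the complex is then pure of
   dimension 2 and every edge lies in exactly two triangles. *)
Definition closed_surface K : Prop :=
  [/\ simplicial_complex K, vertices K = [set: V], connected_complex K &
      forall v, circle (link K v)].

Definition valence K v : nat := #|[set t in triangles K | v \in t]|.

Definition three_divisible K : Prop := (forall v, 3 %| valence K v)%N.

(** * Orientations *)

(* [o u v w] says that u, v, w, in this cyclic order, span a positively
   oriented triangle.  The last clause is coherence: two distinct triangles
   never induce the same direction on a common edge. *)
Definition orientation K (o : V -> V -> V -> bool) : Prop :=
  [/\ forall u v w, o u v w -> [set u; v; w] \in triangles K,
      forall u v w, o u v w -> o v w u,
      forall u v w, [set u; v; w] \in triangles K -> o u v w (+) o u w v &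
      forall u v w x, o u v w -> o u v x -> w = x].

Definition orientable K : Prop := exists o, orientation K o.

(** * 2-circuit decompositions *)

(* The cyclic sequence is the list s, with [ordS] the successor of indices
   modulo [size s]. *)
Definition window (s : seq V) (i : 'I_(size s)) : {set V} :=
  let x := tnth (in_tuple s) in [set x i; x (ordS i); x (ordS (ordS i))].

Definition two_circuit K (s : seq V) : Prop :=
  [/\ s != [::], forall i, window (s := s) i \in triangles K &
      injective (window (s := s))].

Definition two_circuit_decomposition K (D : seq (seq V)) : Prop :=
  {in D, forall s, two_circuit K s} /\
  {in triangles K, forall t,
     count (fun s => [exists i, window (s := s) i == t]) D = 1%N}.

Definition has_two_circuit_decomposition K : Prop :=
  exists D, two_circuit_decomposition K D.

(** * Angles along edge paths *)

(* With positive triangles read counterclockwise, the clockwise neighbour of w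
   in the link of v is the x such that v, x, w is positively oriented. *)
Definition cw_next (o : V -> V -> V -> bool) v w : V :=
  odflt w [pick x | o v x w].

(* For e1 = [u, v] and e2 = [v, w], the number of clockwise steps from w to u
   in the link of v. *)
Definition angle o (e1 e2 : V * V) : nat :=
  findex (cw_next o e1.2) e2.2 e1.1.

(* A closed edge path at v0 is the list x_1, ..., x_n of the endpoints of its
   edges [v0, x_1], [x_1, x_2], ..., so that x_n = v0. *)
Definition closed_path K v0 (p : seq V) : bool :=
  path (edge K) v0 p && (last v0 p == v0).

Definition path_edges v0 (p : seq V) : seq (V * V) := pairmap pair v0 p.

Definition theta_path o v0 (p : seq V) : nat :=
  let es := path_edges v0 p in
  (\sum_(ee <- zip es (rot 1 es)) angle o ee.1 ee.2)%N.

(** * Simplicial cohomology in degree 1 with coefficients in Z/3 *)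

(* Cochains are alternating functions on ordered pairs of vertices, supported
   on the edges of the complex. *)
Definition cocycle1_pred K : {pred {ffun V * V -> 'Z_3}} :=
  fun c =>
  [&& [forall u, forall v, c (v, u) == - c (u, v)],
      [forall u, forall v, ~~ edge K u v ==> (c (u, v) == 0)] &
      [forall u, forall v, forall w, ([set u; v; w] \in triangles K) ==>
         (c (u, v) + c (v, w) + c (w, u) == 0)]].

End Complexes.

Section Cohomology.
Variables (V : finType) (K : {set {set V}}).

Lemma cocycle1P (c : {ffun V * V -> 'Z_3}) :
  reflect [/\ forall u v, c (v, u) = - c (u, v),
              forall u v, ~~ edge K u v -> c (u, v) = 0 &
              forall u v w, [set u; v; w] \in triangles K ->
                 c (u, v) + c (v, w) + c (w, u) = 0]
          (c \in cocycle1_pred K).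
Proof.
apply: (iffP and3P) => [[/forallP h1 /forallP h2 /forallP h3]|[h1 h2 h3]].
  split=> [u v|u v|u v w].
  - by have /forallP/(_ v)/eqP := h1 u.
  - by have /forallP/(_ v)/implyP h := h2 u; move=> /h/eqP.
  - by have /forallP/(_ v)/forallP/(_ w)/implyP h := h3 u; move=> /h/eqP.
split.
- by apply/forallP=> u; apply/forallP=> v; apply/eqP.
- by apply/forallP=> u; apply/forallP=> v; apply/implyP=> /h2 ->.
- apply/forallP=> u; apply/forallP=> v; apply/forallP=> w.
  by apply/implyP=> /h3 ->.
Qed.

Fact cocycle1_zmod_closed : zmod_closed (cocycle1_pred K).
Proof.
split=> [|c d /cocycle1P[c1 c2 c3] /cocycle1P[d1 d2 d3]]; apply/cocycle1P.
  by split=> [u v|u v _|u v w _]; rewrite !ffunE ?oppr0 ?addr0.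
split=> [u v|u v uv|u v w uvw]; rewrite !ffunE.
- by rewrite c1 d1 opprD.
- by rewrite c2 // d2 // subrr.
- by rewrite -(subr0 0) -{1}(c3 _ _ _ uvw) -(d3 _ _ _ uvw) !opprD !addrA
     -!(addrAC _ _ (- d (u, v))) -!(addrAC _ _ (- d (v, w))).
Qed.

HB.instance Definition _ :=
  GRing.isZmodClosed.Build _ (cocycle1_pred K) cocycle1_zmod_closed.

Record cocycle1 := Cocycle1 {
  cochain1 :> {ffun V * V -> 'Z_3};
  cochain1P : cochain1 \in cocycle1_pred K }.

HB.instance Definition _ := [isSub for cochain1].
HB.instance Definition _ := [Choice of cocycle1 by <:].
HB.instance Definition _ := [SubChoice_isSubZmodule of cocycle1 by <:].

Definition coboundary1 : {pred cocycle1} :=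
  fun c => [exists g : {ffun V -> 'Z_3}, forall u, forall v,
    edge K u v ==> (c (u, v) == g v - g u)].

Lemma coboundary1P (c : cocycle1) :
  reflect (exists g : {ffun V -> 'Z_3},
             forall u v, edge K u v -> c (u, v) = g v - g u)
          (c \in coboundary1).
Proof.
apply: (iffP existsP) => -[g h]; exists g.
  by move=> u v; have /forallP/(_ u)/forallP/(_ v)/implyP h' := h => /h'/eqP.
by apply/forallP=> u; apply/forallP=> v; apply/implyP=> /h ->.
Qed.

Fact coboundary1_zmod_closed : zmod_closed coboundary1.
Proof.
split=> [|c d /coboundary1P[g gP] /coboundary1P[h hP]]; apply/coboundary1P.
  by exists 0 => u v _; rewrite !ffunE subrr.
exists (g - h) => u v uv; rewrite !ffunE gP // hP //.
by rewrite !opprD !opprK addrACA.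
Qed.

HB.instance Definition _ :=
  GRing.isZmodClosed.Build _ coboundary1 coboundary1_zmod_closed.

Definition H1_Z3 : zmodType := Quotient.quot coboundary1.

(* Evaluation of a cohomology class on the homology class of the closed path p.
   The choice of the representing cocycle is immaterial, see [H1_evalE]. *)
Definition H1_eval (x : H1_Z3) v0 (p : seq V) : 'Z_3 :=
  \sum_(e <- path_edges v0 p) cochain1 (repr x) e.

End Cohomology.

Section Evaluation.
Variables (V : finType) (K : {set {set V}}).
Implicit Types (u v : V) (p : seq V).

Lemma sum_coboundary (g : V -> 'Z_3) v p :
  \sum_(e <- path_edges v p) (g e.2 - g e.1) = g (last v p) - g v.
Proof.
elim: p v => [|x p IH] v /=; first by rewrite big_nil subrr.
by rewrite big_cons IH /= addrC subrKA.
Qed.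

Lemma mem_path_edges v p e :
  path (edge K) v p -> e \in path_edges v p -> edge K e.1 e.2.
Proof.
elim: p v => [|x p IH] v //= /andP[vx xp].
by rewrite inE => /orP[/eqP ->|/IH]; last exact.
Qed.

Lemma H1_evalE (c : cocycle1 K) v p : closed_path K v p ->
  H1_eval (\pi_(H1_Z3 K) c)%qT v p = \sum_(e <- path_edges v p) cochain1 c e.
Proof.
case/andP=> vp /eqP vl.
have /coboundary1P[g gP] : repr (\pi_(H1_Z3 K) c)%qT - c \in @coboundary1 _ K.
  by rewrite Quotient.idealrBE reprK.
have g0 : \sum_(e <- path_edges v p) (g e.2 - g e.1) = 0.
  by rewrite sum_coboundary vl subrr.
apply/eqP; rewrite -subr_eq0 -sumrB -[X in _ == X]g0; apply/eqP/eq_big_seq.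
by move=> -[a b] /(mem_path_edges vp)/gP /= <-; rewrite !ffunE.
Qed.

End Evaluation.

(** * The obstruction class *)

Section Obstruction.
Variables (V : finType) (K : {set {set V}}).

(* The class in H^1(K; Z/3) which the universal coefficient isomorphism
   H^1(K; Z/3) = Hom(H_1(K), Z/3) matches with the homomorphism
   [p] |-> theta(p) mod 3: its value on the homology class of every closed edge
   path p at v0 is theta(p) mod 3. *)
Definition corresponds_to_theta o v0 (x : H1_Z3 K) : Prop :=
  forall p, closed_path K v0 p -> H1_eval x v0 p = (theta_path o v0 p)%:R.

(* By [theta_classP] and [corresponds_to_theta_inj] below, this is the one and
   only class corresponding to theta. *)
Definition theta_class o v0 : H1_Z3 K :=
  epsilon (inhabits 0) (corresponds_to_theta o v0).

Lemma corresponds_to_theta_inj o v0 x y :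
  closed_surface K ->
  corresponds_to_theta o v0 x -> corresponds_to_theta o v0 y -> x = y.
Proof.
move=> [_ vK [_ conn] _] hx hy.
have {}conn w : connect (edge K) v0 w by apply: conn; rewrite vK inE.
have symK a b : edge K a b = edge K b a by rewrite /edge eq_sym setUC.
pose c := repr x - repr y.
have c_closed p : closed_path K v0 p ->
    \sum_(e <- path_edges v0 p) cochain1 c e = 0.
  move=> pP; have := hx p pP; rewrite -(hy p pP) /H1_eval => /eqP.
  rewrite -subr_eq0 -sumrB => /eqP s0; apply: etrans s0.
  by apply: eq_bigr => e _; rewrite !ffunE.
suff /coboundary1P cb : exists g : {ffun V -> 'Z_3},
    forall u v, edge K u v -> cochain1 c (u, v) = g v - g u.
  by apply/eqP; rewrite -[x]reprK -[y]reprK -Quotient.idealrBE.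
have to_path w : exists p, path (edge K) v0 p && (last v0 p == w).
  by have /connectP[p pp ->] := conn w; exists p; rewrite pp eqxx.
pose P w := xchoose (to_path w).
have PP w : path (edge K) v0 (P w) && (last v0 (P w) == w).
  exact: xchooseP (to_path w).
pose sm v p := \sum_(e <- path_edges v p) cochain1 c e.
have /cocycle1P[alt _ _] := cochain1P c.
have sm_cat v p q : sm v (p ++ q) = sm v p + sm (last v p) q.
  by rewrite /sm /path_edges pairmap_cat big_cat.
have last_rev v p : last (last v p) (rev (belast v p)) = v.
  by case: p => [|b p] //=; rewrite rev_cons last_rcons.
have sm_rev v p : sm (last v p) (rev (belast v p)) = - sm v p.
  elim: p v => [|a p IH] v /=; first by rewrite /sm /= big_nil oppr0.
  rewrite rev_cons -cats1 sm_cat IH.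
  rewrite last_rev /sm /= !big_cons big_nil addr0 opprD addrC.
  by congr (_ - _); rewrite alt.
exists [ffun w => sm v0 (P w)] => u v uv; rewrite !ffunE.
have /andP[pu /eqP lu] := PP u; have /andP[pv /eqP lv] := PP v.
have /c_closed : closed_path K v0 (P u ++ v :: rev (belast v0 (P v))).
  rewrite /closed_path cat_path last_cat /= lu uv pu /=.
  rewrite -{1}lv rev_path (eq_path (e' := edge K)) ?pv /=; last first.
    by move=> a b; rewrite symK.
  by have := @last_rev _ v0 (P v); rewrite lv => ->.
rewrite -/(sm _ _) sm_cat lu -cat1s sm_cat /= -{2}lv sm_rev.
rewrite {2}/sm /= big_cons big_nil addr0 addrA => /eqP.
rewrite subr_eq0 => /eqP e.
by rewrite -e !ffunE addrAC subrr add0r.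
Qed.

Section Existence.
Hypotheses (surfK : closed_surface K) (divK : three_divisible K).
Variable o : V -> V -> V -> bool.
Hypothesis orient : orientation K o.

Let o_tri u v w : o u v w -> [set u; v; w] \in triangles K.
Proof. by case: orient => h _ _ _; apply: h. Qed.
Let o_rot u v w : o u v w -> o v w u.
Proof. by case: orient => _ h _ _; apply: h. Qed.
Let o_xor u v w : [set u; v; w] \in triangles K -> o u v w (+) o u w v.
Proof. by case: orient => _ _ h _; apply: h. Qed.
Let o_inj u v w x : o u v w -> o u v x -> w = x.
Proof. by case: orient => _ _ _ h; apply: h. Qed.
Let o_inj' u v w x : o u v x -> o u w x -> v = w.
Proof. by move=> /o_rot/o_rot h /o_rot/o_rot; apply: o_inj h. Qed.

Let set3C (u v w : V) : [set u; v; w] = [set u; w; v].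
Proof. by rewrite -!setUA (setUC [set v]). Qed.

Let triE (u v w : V) : [set u; v; w] \in triangles K =
  [&& [set u; v; w] \in K, u != v, u != w & v != w].
Proof.
rewrite inE; congr (_ && _); rewrite (setUC [set u; v]) cardsU1 cards2 !inE.
rewrite negb_or (eq_sym w u) (eq_sym w v).
by case: (u == v); case: (u == w); case: (v == w).
Qed.

Let lkv v : {set V} := vertices (link K v).

Let lkvE v w : (w \in lkv v) = edge K v w.
Proof.
rewrite !inE /edge; case: (eqVneq v w) => [_|_]; rewrite ?andbF //=.
by case: surfK => _ /setP/(_ w); rewrite !inE => ->.
Qed.

Let cl (s t : {set V}) : t \in K -> s \subset t -> s != set0 -> s \in K.
Proof. by case: surfK => -[_ h] _ _ _; apply: h. Qed.

Let set_neq0 (x : V) (A : {set V}) : x \in A -> A != set0.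
Proof. by move=> xA; apply/set0Pn; exists x. Qed.

Let lk_edge v a b :
  [set v; a; b] \in triangles K -> edge K v a /\ edge K v b.
Proof.
rewrite triE => /and4P[t va vb ab]; rewrite /edge va vb.
split; apply: (cl t); rewrite ?(@set_neq0 v) ?inE ?eqxx //.
  exact: subsetUl.
by apply/subsetP => z; rewrite !inE => /orP[] ->; rewrite ?orbT.
Qed.

Let lk_edgeE v a b : edge (link K v) a b = ([set v; a; b] \in triangles K).
Proof.
rewrite triE /edge inE !inE negb_or setUA.
apply/idP/idP; first by case/and4P=> -> _ /andP[-> ->] ->.
case/and4P=> t -> -> ->; rewrite t !andbT /=.
apply: (cl t); last by rewrite (@set_neq0 a) ?inE ?eqxx.
by apply/subsetP => z; rewrite !inE => /orP[] ->; rewrite ?orbT.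
Qed.

Let card_nbr v w : edge K v w -> #|[set x | [set v; w; x] \in triangles K]| = 2%N.
Proof.
rewrite -lkvE => wv; case: surfK => _ _ _ /(_ v) [_ _ _ /(_ w wv)] <-.
rewrite -(card_in_imset (f := fun x => [set w; x])); last first.
  move=> x y; rewrite [x \in _]inE [y \in _]inE !triE.
  move=> /and4P[_ _ _ wx] /and4P[_ _ _ wy] /setP e.
  by have := e x; rewrite !inE eqxx orbT eq_sym (negPf wx) => /esym/eqP.
congr #|pred_of_set _|; apply/setP => t; apply/imsetP/idP.
  case=> x; rewrite inE -lk_edgeE => /andP[wx l] ->.
  by rewrite inE l cards2 wx !inE eqxx.
rewrite inE => /and3P[tl t2 wt].
have /cards1P[x tx] : #|t :\ w| == 1%N by rewrite -(eqn_add2l 1) -{1}[1%N]/(true : nat) -wt -cardsD1.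
have te : t = [set w; x] by rewrite -(setD1K wt) tx.
exists x => //; rewrite inE -lk_edgeE /edge -te tl andbT.
by apply: contraTneq t2 => e; rewrite te e setUid cards1.
Qed.

Let ex_prev v w : edge K v w -> exists x, o v x w.
Proof.
move=> /card_nbr/eqP/cards2P[x [y [xy e]]].
have hx : [set v; w; x] \in triangles K by have /setP/(_ x) := e; rewrite !inE eqxx.
have hy : [set v; w; y] \in triangles K.
  by have /setP/(_ y) := e; rewrite !inE eqxx orbT.
case xw: (o v x w); first by exists x.
case yw: (o v y w); first by exists y.
have := o_xor hx; have := o_xor hy; rewrite xw yw !addbF => h1 h2.
by rewrite (o_inj h1 h2) eqxx in xy.
Qed.

Let cw_o v w : edge K v w -> o v (cw_next o v w) w.
Proof.
move=> /ex_prev[x xw]; rewrite /cw_next.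
by case: pickP => [y //|/(_ x)]; rewrite xw.
Qed.

Let cw_eq v x w : o v x w -> cw_next o v w = x.
Proof.
move=> xw; apply: (@o_inj' v _ _ w) => //; apply: cw_o.
by case: (lk_edge (o_tri xw)).
Qed.

Let cw_edge v w : edge K v w -> edge K v (cw_next o v w).
Proof. by move=> /cw_o/o_tri/lk_edge[]. Qed.

Let cw_inj v : injective (cw_next o v).
Proof.
have out w : ~~ edge K v w -> cw_next o v w = w.
  move=> vw; rewrite /cw_next; case: pickP => //= x /o_tri/lk_edge[_].
  by rewrite (negPf vw).
move=> a b e; have [va|va] := boolP (edge K v a).
  have [vb|vb] := boolP (edge K v b).
    by apply: (@o_inj v (cw_next o v a)); [|rewrite e]; apply: cw_o.
  by rewrite (out _ vb) in e; rewrite -e cw_edge in vb.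
have [vb|vb] := boolP (edge K v b); last by rewrite !out in e.
by rewrite (out _ va) in e; rewrite e cw_edge in va.
Qed.

Let cw_conn v a b : edge K v a -> edge K v b -> fconnect (cw_next o v) a b.
Proof.
rewrite -!lkvE => va vb; case: surfK => _ _ _ /(_ v)[_ [_ h] _ _].
apply: connect_sub (h _ _ va vb) => x y; rewrite lk_edgeE => /o_xor.
case xy: (o v x y) => /= yx; last by rewrite -(cw_eq yx) fconnect1.
by rewrite (fconnect_sym (@cw_inj v)) -(cw_eq xy) fconnect1.
Qed.

Let order_cw v a : edge K v a -> (3 %| order (cw_next o v) a)%N.
Proof.
move=> va; suff -> : order (cw_next o v) a = valence K v by apply: divK.
rewrite /order /valence.
rewrite -(card_in_imset (D := fconnect (cw_next o v) a)
            (f := fun w => [set v; w; cw_next o v w])).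
  have con w : (w \in fconnect (cw_next o v) a) = edge K v w.
    apply/idP/idP => [|vw]; last exact: cw_conn.
    rewrite inE => /iter_findex <-.
    by elim: (findex _ _ _) => //= n; apply: cw_edge.
  apply: eq_card => t; apply/imsetP/idP.
    case=> w; rewrite con => vw ->; rewrite inE set3C.
    by rewrite (o_tri (cw_o vw)) !inE eqxx.
  rewrite inE => /andP[]; rewrite inE => /andP[tK t3] vt.
  have /cards2P[x [y [xy te]]] : #|t :\ v| == 2%N.
    by rewrite -(eqn_add2l 1) -{1}[1%N]/(true : nat) -vt -cardsD1.
  have {}te : t = [set v; x; y] by rewrite -(setD1K vt) te setUA.
  have tT : [set v; x; y] \in triangles K by rewrite -te inE tK t3.
  have [vx vy] := lk_edge tT; have := o_xor tT.
  case oxy: (o v x y) => /= oyx.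
    by exists y; rewrite ?con // (cw_eq oxy) te set3C.
  by exists x; rewrite ?con // (cw_eq oyx).
move=> x y cx cy e.
have con w : (w \in fconnect (cw_next o v) a) -> edge K v w.
  by rewrite inE => /iter_findex <-; elim: (findex _ _ _) => //= n; apply: cw_edge.
have {cx cy} [/con vx /con vy] := (cx, cy).
have ox := cw_o vx; have oy := cw_o vy.
have := o_tri ox; have := o_tri oy.
rewrite !triE => /and4P[_ vcy vy' cyy] /and4P[_ vcx vx' cxx].
apply: contraTeq isT => xy.
have /setP/(_ x) := e; rewrite !inE eqxx orbT /= [x == v]eq_sym.
rewrite (negPf vx') (negPf xy) /= => /esym/eqP xe.
have /setP/(_ y) := e; rewrite !inE eqxx orbT /= [y == v]eq_sym [y == x]eq_sym.
rewrite (negPf vy') (negPf xy) /= => /eqP ye.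
have := o_xor (o_tri ox); rewrite ox -ye.
by move: oy; rewrite -xe => ->.
Qed.

Let findexD v a b c : edge K v a -> edge K v b -> edge K v c ->
  (findex (cw_next o v) a c)%:R =
  (findex (cw_next o v) a b)%:R + (findex (cw_next o v) b c)%:R :> 'Z_3.
Proof.
move=> va vb vc; set f := cw_next o v; set n := order f a.
have fab := cw_conn va vb; have fbc := cw_conn vb vc; have fac := cw_conn va vc.
have n0 : (0 < n)%N by apply: order_gt0.
have it m : iter m f a = iter (m %% n) f a.
  rewrite {1}(divn_eq m n) addnC iterD; congr (iter _ f _).
  by elim: (m %/ n)%N => //= k IH; rewrite mulSn iterD IH (iter_order (@cw_inj v)).
have e : iter (findex f b c + findex f a b) f a = c.
  by rewrite iterD iter_findex // iter_findex.
have -> : findex f a c = ((findex f b c + findex f a b) %% n)%N.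
  by rewrite -{1}e it findex_iter // ltn_mod.
rewrite -natrD [in RHS]addnC.
rewrite [in RHS](divn_eq (findex f b c + findex f a b) n) natrD natrM.
have /dvdnP[k ->] : (3 %| n)%N := order_cw va.
by rewrite (natrM _ k 3) (_ : 3%:R = 0 :> 'Z_3) ?mulr0 ?add0r //; apply/val_inj.
Qed.

Let base v : V := odflt v [pick w | edge K v w].

Let base_edge v w : edge K v w -> edge K v (base v).
Proof. by move=> vw; rewrite /base; case: pickP => //= /(_ w); rewrite vw. Qed.

Let pos v w : 'Z_3 := (findex (cw_next o v) (base v) w)%:R.

Let pos_angle a v b : edge K v a -> edge K v b ->
  (angle o (a, v) (v, b))%:R = pos v a - pos v b.
Proof.
move=> va vb; rewrite /pos (findexD (base_edge va) vb va).
by rewrite addrAC subrr add0r.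
Qed.

Let posS v x w : o v x w -> pos v x - pos v w = 1.
Proof.
move=> ox; have [vx vw] := lk_edge (o_tri ox).
rewrite -pos_angle // /angle /= -(cw_eq ox).
case: (leqP (order (cw_next o v) w) 1) => [|h].
  move=> h; have := order_cw vw; move: h (order_gt0 (cw_next o v) w).
  by case: (order _ _) => [|[|]].
by rewrite (findex_iter (i := 1)).
Qed.

Let edgeC a b : edge K a b = edge K b a.
Proof. by rewrite /edge eq_sym setUC. Qed.

Let theta_cochain : {ffun V * V -> 'Z_3} :=
  [ffun e => if edge K e.1 e.2 then pos e.2 e.1 - pos e.1 e.2 else 0].

Let theta_cocycle : theta_cochain \in cocycle1_pred K.
Proof.
have swap a b : theta_cochain (b, a) = - theta_cochain (a, b).
  by rewrite !ffunE /= edgeC; case: ifP; rewrite ?oppr0 // opprB.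
have three : 1 + 1 + 1 = 0 :> 'Z_3 by apply/val_inj.
have pos_case u v w : o u v w ->
    theta_cochain (u, v) + theta_cochain (v, w) + theta_cochain (w, u) = 0.
  move=> h; have h1 := o_rot h; have h2 := o_rot h1.
  have [uv uw] := lk_edge (o_tri h); have [vw vu] := lk_edge (o_tri h1).
  rewrite !ffunE /= uv vw (edgeC w u) uw.
  have -> : pos v u = pos v w - 1 by rewrite -(posS h1) opprB addrC subrK.
  have -> : pos w v = pos w u - 1 by rewrite -(posS h2) opprB addrC subrK.
  have -> : pos u w = pos u v - 1 by rewrite -(posS h) opprB addrC subrK.
  rewrite -[RHS]oppr0 -three !opprD.
  rewrite -!addrA !(addrCA _ (-1)); congr (_ + (_ + _)).
  rewrite -[RHS]addr0; congr (_ + _).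
  rewrite !addrA (addrAC _ _ (- pos v w)) (addrAC _ _ (- pos v w)) subrr add0r.
  by rewrite (addrAC (- pos u v)) addNr add0r subrr.
apply/cocycle1P; split=> [u v|u v nuv|u v w t]; first exact: swap.
  by rewrite ffunE /= (negPf nuv).
have := o_xor t; case ow: (o u v w) => /= h; first exact: pos_case.
rewrite (swap v u) (swap w v) (swap u w) -!opprD addrC addrA.
by rewrite -[RHS]oppr0 -(pos_case _ _ _ h) addrAC [X in - (X + _)]addrC.
Qed.

Let theta_sum (e0 : V * V) y v p :
  edge K y v -> path (edge K) v p -> last v p = e0.1 -> edge K e0.1 e0.2 ->
  \sum_(ee <- zip ((y, v) :: path_edges v p) (rcons (path_edges v p) e0))
     (angle o ee.1 ee.2)%:R =
  pos v y + \sum_(e <- path_edges v p) theta_cochain e - pos e0.1 e0.2 :> 'Z_3.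
Proof.
elim: p y v => [|x p IH] y v yv /=.
  case: e0 => a b _ /= <- vb; rewrite big_cons !big_nil !addr0 pos_angle //.
  by rewrite edgeC.
move=> /andP[vx xp] lx e0e; rewrite !big_cons -/(path_edges x p).
rewrite IH //= pos_angle //; last by rewrite edgeC.
by rewrite ffunE /= vx !addrA; congr (_ + _ - _); rewrite addrAC.
Qed.

Lemma theta_exists v0 : exists x, corresponds_to_theta o v0 x.
Proof.
exists (\pi_(H1_Z3 K) (Cocycle1 theta_cocycle))%qT => p cp.
rewrite (H1_evalE _ cp) /=; case/andP: cp; rewrite /theta_path.
case: p => [|x p] /=; first by rewrite !big_nil.
move=> /andP[vx xp] /eqP lx; rewrite rot1_cons natr_sum -/(path_edges x p).
rewrite (@theta_sum (v0, x)) //= big_cons ffunE /= vx.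
by rewrite -!addrA; congr (_ + _); rewrite addrC.
Qed.

End Existence.

Lemma theta_classP o v0 :
  closed_surface K -> three_divisible K -> orientation K o ->
  corresponds_to_theta o v0 (theta_class o v0).
Proof. by move=> h1 h2 h3; apply: epsilon_spec; apply: theta_exists. Qed.

End Obstruction.

(** * Orientable double covers *)

(* A simplicial covering map p with two sheets: p is simplicial and
   nondegenerate, and above each simplex s of K lie exactly two simplices of L;
   they are disjoint and their union is the whole preimage of s. *)
Definition double_cover (V W : finType) (K : {set {set V}}) (L : {set {set W}})
    (p : W -> V) : Prop :=
  {in L, forall t : {set W}, p @: t \in K /\ {in t &, injective p}} /\
  {in K, forall s : {set V},
     let lifts := [set t in L | p @: t == s] in
     #|lifts| = 2%N /\ partition lifts (p @^-1: s)}.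

(* [orientable_model K L]: L is K itself if K is orientable, and is the
   orientable double cover of K with the lifted triangulation otherwise. *)
Inductive orientable_model (V : finType) (K : {set {set V}}) :
    forall W : finType, {set {set W}} -> Prop :=
| OrientableSelf : orientable K -> orientable_model K K
| OrientableCover (W : finType) (L : {set {set W}}) (p : W -> V) :
    ~ orientable K -> closed_surface L -> orientable L -> double_cover K L p ->
    orientable_model K L.

(* Main.v *)
Require Import Defs.
From mathcomp Require Import all_boot all_order all_algebra.
From mathcomp Require Import ring.

(** A 2-circuit crosses each of its triangles [v_i v_(i+1) v_(i+2)] around the
middle vertex [v_(i+1)], and it enters the next triangle through the edge
[v_(i+1) v_(i+2)], whose other end [v_(i+2)] is the next middle vertex.  Hence a
2-circuit decomposition amounts to a choice [m t] of a vertex in every triangle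
[t], here called a turning, such that for two triangles [abx], [aby] on an edge
[ab] the choice of [a] in the first forces the choice of [b] in the second
([decomposition_turning]).  Conversely the 2-circuits of a turning are the
orbits of the map that sends a triangle with a direction of travel to its
successor; reversal of the direction exchanges the orbits in pairs, and no orbit
is its own reversal ([no_reversal]).

The rule transports the chosen vertex bijectively across each edge ([a] to [b],
[b] to [a], [x] to [y]), so turnings are the global sections of a covering of
the surface with three sheets.  On an oriented surface the transport is
compatible with the cyclic orientation of the triangles.  A turning is therefore
the same as a labelling of the unoriented edges by Z/3 whose labels increase by
1 when one goes around a positive triangle ([opposite_vertex_turning],
[coordinate_of_turning]).  Read at a vertex [v], this means that the labels of
the edges at [v] increase by 1 with each clockwise step, so that they count
angles mod 3.

If only the last condition is imposed, separately at each vertex, one gets an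
angular coordinate [f v w] on directed edges.  It exists because the surface is
3-divisible, and the angle from [uv] to [vw] is [f v u - f v w] mod 3.
Regrouping by edges, theta(p) is the sum along [p] of the cocycle
[f v u - f u v] ([theta_path_cochain]), so this cocycle represents the class
theta.  It is the coboundary of some [g] exactly if the new coordinates
[f v w - g v] take one value on both directions of every edge, which makes them
a labelling as above ([theta_class_eq0]).  This settles the orientable case.

Let now [p : L -> K] be a double cover with [L] oriented.  A turning of [K]
lifts to [L].  Conversely, if theta vanishes on [L], the labels k in Z/3 give
three turnings of [L], one for each vertex of a given triangle.  As a turning is
determined by its value on one triangle ([turning_uniq]), there are no others,
and the deck transformation permutes the three.  An involution on three objects
has a fixed point, and an invariant turning descends to [K]
([turning_descends]). *)

Set Implicit Arguments.
Unset Strict Implicit.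
Unset Printing Implicit Defensive.

Import GRing.Theory.
Local Open Scope ring_scope.

(** * Triangles, stars and strong connectedness *)

Lemma connect_invariant (T : finType) (e : rel T) (P : T -> Prop) x y :
  (forall a b, e a b -> P a -> P b) -> connect e x y -> P x -> P y.
Proof.
move=> eP /connectP[p xp ->]; elim: p x xp => //= z p IH x /andP[xz zp] Px.
exact: IH zp (eP _ _ xz Px).
Qed.

Section Sets.
Variables (V : finType) (K : {set {set V}}).
Implicit Types (a b c u v w x y z : V) (s t : {set V}).

Definition tri a b c := [set a; b; c] \in triangles K.

Lemma set3_rot a b c : [set a; b; c] = [set b; c; a].
Proof. by rewrite -setUA setUC. Qed.

Lemma set3_swap a b c : [set a; b; c] = [set b; a; c].
Proof. by rewrite (setUC [set a]). Qed.

Lemma tri_rot a b c : tri a b c = tri b c a.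
Proof. by rewrite /tri set3_rot. Qed.

Lemma tri_swap a b c : tri a b c = tri b a c.
Proof. by rewrite /tri set3_swap. Qed.

Lemma set3_swapr a b c : [set a; b; c] = [set a; c; b].
Proof. by rewrite -!setUA (setUC [set b]). Qed.

Lemma tri_swapr a b c : tri a b c = tri a c b.
Proof. by rewrite /tri set3_swapr. Qed.

Lemma card_set3 a b c :
  (#|[set a; b; c]| == 3%N) = [&& a != b, a != c & b != c].
Proof.
rewrite (setUC [set a; b]) cardsU1 cards2 !inE negb_or !(eq_sym c).
by case: (a == b); case: (a == c); case: (b == c).
Qed.

Lemma triE a b c :
  tri a b c = [&& [set a; b; c] \in K, a != b, a != c & b != c].
Proof. by rewrite /tri inE card_set3. Qed.

Lemma tri_neq a b c : tri a b c -> [/\ a != b, a != c & b != c].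
Proof. by rewrite triE => /and4P[]. Qed.

Lemma triangle_at t a : t \in triangles K -> a \in t ->
  exists b c, t = [set a; b; c].
Proof.
rewrite inE => /andP[_ t3] at'.
have /cards2P[b [c [_ tbc]]] : #|t :\ a| == 2%N.
  by rewrite (cardsD1 a) at' in t3.
by exists b, c; rewrite -(setD1K at') tbc setUA.
Qed.

Lemma triangle_vertex t : t \in triangles K -> exists a, a \in t.
Proof.
move=> tK; apply/set0Pn; apply: contraTneq tK => ->.
by rewrite inE cards0 andbF.
Qed.

Lemma edgeC a b : edge K a b = edge K b a.
Proof. by rewrite /edge eq_sym setUC. Qed.

End Sets.

Section Surface.
Variables (V : finType) (K : {set {set V}}).
Hypothesis surfK : closed_surface K.
Implicit Types (a b c u v w x y z : V) (s t : {set V}).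
Notation tri := (tri K).

Lemma face_mem s t : t \in K -> s \subset t -> s != set0 -> s \in K.
Proof. by case: surfK => -[_ h] _ _ _; apply: h. Qed.

Lemma vertex_mem v : [set v] \in K.
Proof. by case: surfK => _ /setP/(_ v) + _ _; rewrite !inE. Qed.

Lemma surface_vertex : exists v : V, [set v] \in K.
Proof.
case: surfK => -[K0 _] _ [/set0Pn[t tK] _] _.
have /set0Pn[v _] : t != set0 by apply: contraNneq K0 => <-.
by exists v; apply: vertex_mem.
Qed.

Lemma tri_edge a b c : tri a b c -> edge K a b.
Proof.
rewrite triE /edge => /and4P[t -> _ _]; apply: (face_mem t) => /=.
  by apply/subsetP => x; rewrite !inE => ->.
by apply/set0Pn; exists a; rewrite !inE eqxx.
Qed.

Lemma link_edge v a b : edge (link K v) a b = tri v a b.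
Proof.
rewrite triE /edge inE !inE negb_or setUA.
apply/idP/idP; first by case/and4P=> -> _ /andP[-> ->] ->.
case/and4P=> t -> -> ->; rewrite t !andbT /=.
apply: (face_mem t); last by apply/set0Pn; exists a; rewrite !inE eqxx.
by apply/subsetP => x; rewrite !inE => /orP[] ->; rewrite ?orbT.
Qed.

Lemma link_vertex v a : (a \in vertices (link K v)) = edge K v a.
Proof. by rewrite !inE /edge vertex_mem. Qed.

Lemma link_connect v a b : edge K v a -> edge K v b ->
  connect (edge (link K v)) a b.
Proof.
by rewrite -!link_vertex; case: surfK => _ _ _ /(_ v)[_ [_ h] _ _]; apply: h.
Qed.

(** Every edge lies in exactly two triangles, because a vertex of a circle lies
on exactly two of its edges. *)
Lemma two_triangles v w : edge K v w ->
  exists x y, x != y /\ forall z, tri v w z = (z == x) || (z == y).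
Proof.
rewrite -link_vertex => wv; case: surfK => _ _ _ /(_ v)[_ _ _ /(_ w wv)].
set E := [set t in _ | _] => /eqP E2.
have tE z : tri v w z = (w != z) && ([set w; z] \in E).
  rewrite -link_edge /edge !inE cards2 eqxx /=.
  by case: (w == z); rewrite ?andbF ?andbT.
have pairE t : t \in E -> exists2 z, w != z & t = [set w; z].
  rewrite inE => /and3P[_ t2 wt].
  have /cards1P[z tz] : #|t :\ w| == 1%N by rewrite (cardsD1 w) wt in t2.
  exists z; last by rewrite -(setD1K wt) tz.
  by have := set11 z; rewrite -tz !inE eq_sym => /andP[].
have /cards2P[s [t [st Est]]] := E2.
have [x wx sx] : exists2 z, w != z & s = [set w; z].
  by apply: pairE; rewrite Est !inE eqxx.
have [y wy ty] : exists2 z, w != z & t = [set w; z].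
  by apply: pairE; rewrite Est !inE eqxx orbT.
have inj a b : w != a -> ([set w; a] == [set w; b]) = (a == b).
  move=> wa; apply/eqP/eqP => [/setP/(_ a)|-> //].
  by rewrite !inE eqxx orbT eq_sym (negPf wa) => /esym/eqP.
exists x, y; split; first by apply: contraNneq st; rewrite sx ty => ->.
move=> z; rewrite tE Est !inE sx ty ![[set w; z] == _]eq_sym !inj //.
rewrite ![_ == z]eq_sym; case: (eqVneq z w) => //= ->.
by rewrite (negPf wx) (negPf wy).
Qed.

Lemma tri_other v w x : tri v w x ->
  exists y, [/\ x != y, tri v w y & forall z, tri v w z -> z = x \/ z = y].
Proof.
move=> t; have [a [b [ab h]]] := two_triangles (tri_edge t).
move: (t); rewrite h => /orP[]/eqP->; [exists b|exists a]; rewrite h eqxx ?orbT.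
  by split=> // z; rewrite h => /orP[]/eqP; [left|right].
by split=> // [|z]; rewrite 1?eq_sym // h => /orP[]/eqP; [right|left].
Qed.

Lemma other_uniq v w x y z : tri v w x -> tri v w y -> tri v w z ->
  x != y -> x != z -> y = z.
Proof.
move=> /tri_other[u [_ _ h]] /h[->|->] /h[->|->] //; rewrite ?eqxx //.
Qed.

Lemma edge_tri v w : edge K v w -> exists x, tri v w x.
Proof. by move=> /two_triangles[x [y [_ h]]]; exists x; rewrite h eqxx. Qed.

Lemma edge_ex v : exists w, edge K v w.
Proof.
case: surfK => _ _ _ /(_ v)[[l0 lsub] [ln0 _] _ _].
have /set0Pn[t tl] := ln0.
have /set0Pn[w wt] : t != set0 by apply: contraNneq l0 => <-.
exists w; rewrite -link_vertex inE; apply: (lsub _ t) => //.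
  by rewrite sub1set.
by apply/set0Pn; exists w; rewrite inE.
Qed.

Lemma tri_ex v : exists a b, tri v a b.
Proof. by have [w /edge_tri[x]] := edge_ex v; exists w, x. Qed.

(** The surface is strongly connected: triangles sharing an edge propagate a
property around each vertex since links are connected, and then along the
edges. *)
Lemma strong_connectedness (P : {set V} -> Prop) :
  (forall a b x y, tri a b x -> tri a b y -> x != y ->
     P [set a; b; x] -> P [set a; b; y]) ->
  forall a b c, tri a b c -> P [set a; b; c] -> {in triangles K, forall t, P t}.
Proof.
move=> adj a b c t0 P0.
pose Q v w := forall x, tri v w x -> P [set v; w; x].
have QP v w x : tri v w x -> P [set v; w; x] -> Q v w.
  by move=> t Pt y ty; have [<- //|/adj] := eqVneq x y; apply.
pose star v := forall w, edge K v w -> Q v w.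
have starP v w x : tri v w x -> P [set v; w; x] -> star v.
  move=> t Pt u vu; have vw := tri_edge t.
  apply: (connect_invariant (P := Q v)) (link_connect vw vu) (QP _ _ _ t Pt).
  move=> p q; rewrite link_edge => pq /(_ _ pq).
  by rewrite set3_swapr; apply: QP; rewrite tri_swapr.
have all_star v : star v.
  case: surfK => _ Kv [_ /(_ a v)]; rewrite Kv !inE => /(_ isT isT) cav _.
  apply: (connect_invariant (P := star)) cav (starP _ _ _ t0 P0) => p q pq sp.
  have [x tx] := edge_tri pq; have := sp q pq x tx.
  by rewrite set3_swap; apply: starP; rewrite -tri_swap.
move=> t tK; have [v vt] := triangle_vertex tK.
have [w [x tE]] := triangle_at tK vt; rewrite tE in tK *.
exact: all_star (tri_edge tK) _ tK.
Qed.

End Surface.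

(** * Turnings *)

(** The choice of the middle vertices of 2-circuits.  The rule for [m = x] is a
consequence of the two rules for [m = a] and [m = b], see [turning_cross]. *)
Definition turning (V : finType) (K : {set {set V}}) (m : {set V} -> V)
  : Prop :=
  {in triangles K, forall t : {set V}, m t \in t} /\
  forall a b x y, tri K a b x -> tri K a b y -> x != y ->
    m [set a; b; x] = a -> m [set a; b; y] = b.

Section Turning.
Variables (V : finType) (K : {set {set V}}).
Hypothesis surfK : closed_surface K.
Implicit Types (a b c u v w x y z : V) (t : {set V}).
Notation tri := (tri K).

Lemma turning_mem m a b c : turning K m -> tri a b c ->
  [\/ m [set a; b; c] = a, m [set a; b; c] = b | m [set a; b; c] = c].
Proof.
move=> [+ _] t => /(_ _ t); rewrite !inE -orbA => /or3P[]/eqP;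
by [constructor 1|constructor 2|constructor 3].
Qed.

(** The defining rule determines the turning across an edge completely: if it is
off the edge on one side it cannot be on the edge on the other side. *)
Lemma turning_cross m a b x y : turning K m ->
  tri a b x -> tri a b y -> x != y ->
  [/\ m [set a; b; x] = a -> m [set a; b; y] = b,
      m [set a; b; x] = b -> m [set a; b; y] = a &
      m [set a; b; x] = x -> m [set a; b; y] = y].
Proof.
move=> mK tx ty xy; have [_ mc] := mK.
have mc' x' y' : tri a b x' -> tri a b y' -> x' != y' ->
    m [set a; b; x'] = b -> m [set a; b; y'] = a.
  by rewrite !(tri_swap _ a) !(set3_swap a); apply: mc.
split=> [||mx]; [exact: mc|exact: mc'|].
have [ab ax bx] := tri_neq tx.
rewrite eq_sym in xy; case: (turning_mem mK ty) => // my.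
- by move: bx; rewrite -{1}(mc _ _ _ _ ty tx xy my) mx eqxx.
- by move: ax; rewrite -{1}(mc' _ _ ty tx xy my) mx eqxx.
Qed.

(** A turning is transported across edges, so it is determined by its value on
one triangle. *)
Lemma turning_uniq m m' a b c : turning K m -> turning K m' ->
  tri a b c -> m [set a; b; c] = m' [set a; b; c] -> {in triangles K, m =1 m'}.
Proof.
move=> mK mK' t0 e0.
apply: (strong_connectedness surfK (P := fun t => m t = m' t) _ t0 e0).
move=> {a b c t0 e0} a b x y tx ty xy e.
have [m1 m2 m3] := turning_cross mK tx ty xy.
have [n1 n2 n3] := turning_cross mK' tx ty xy.
case: (turning_mem mK tx) => mx.
- by rewrite m1 // n1 // -e.
- by rewrite m2 // n2 // -e.
- by rewrite m3 // n3 // -e.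
Qed.

(** ** From 2-circuits to turnings *)

Lemma ordS_neq (s : seq V) (i : 'I_(size s)) :
  two_circuit K s -> ordS i != i.
Proof.
move=> [_ /(_ i) + _]; rewrite /window; apply: contraTneq => ->.
by rewrite inE card_set3 eqxx andbF.
Qed.

(** For a decomposition [D] this singles out one vertex of each triangle [t]. *)
Definition middle (D : seq (seq V)) t a : bool :=
  has (fun s => [exists i, (window (s := s) i == t) &&
                           (tnth (in_tuple s) (ordS i) == a)]) D.

Section MiddleOfDecomposition.
Variable D : seq (seq V).
Hypothesis decD : two_circuit_decomposition K D.

Lemma middleP t a : reflect
  (exists (s : seq V) (i : 'I_(size s)),
     [/\ s \in D, two_circuit K s, window i = t &
         tnth (in_tuple s) (ordS i) = a])
  (middle D t a).
Proof.
apply: (iffP hasP) => [[s sD /existsP[i /andP[/eqP e1 /eqP e2]]]|].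
  by exists s, i; split=> //; case: decD => h _; apply: h.
case=> s [i [sD _ e1 e2]]; exists s => //; apply/existsP; exists i.
by rewrite e1 e2 !eqxx.
Qed.

Lemma middle_uniq t a b : t \in triangles K -> middle D t a -> middle D t b ->
  a = b.
Proof.
move=> tK /middleP[s [i [sD sc wi <-]]] /middleP[r [j [rD _ wj <-]]].
suff rs : s = r.
  case: r / rs j rD wj => j _ wj; case: sc => _ _ inj.
  by rewrite (inj i j) // wi wj.
have [_ /(_ t tK)] := decD; set P := (X in count X D).
have Ps : P s by apply/existsP; exists i; rewrite wi.
have Pr : P r by apply/existsP; exists j; rewrite wj.
(* The rest is pure counting: a count of 1 leaves room for one entry only. *)
clearbody P; elim: D sD rD => //= x l IH.
rewrite !inE; case Px: (P x) => /=; last first.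
  move=> /orP[/eqP e|sl]; first by rewrite -e Ps in Px.
  by move=> /orP[/eqP e|rl]; [rewrite -e Pr in Px|apply: IH].
move=> sl rl; rewrite -[RHS]addn0 => /eqP.
rewrite eqn_add2l -leqn0 leqNgt -has_count.
move=> /hasPn nP; move: sl rl => /orP[/eqP ->|/nP]; last by rewrite Ps.
by move=> /orP[/eqP ->|/nP] //; rewrite Pr.
Qed.

Lemma middle_exists t : t \in triangles K -> exists2 a, a \in t & middle D t a.
Proof.
move=> tK; have [dec /(_ t tK) c1] := decD.
have /hasP[s sD /existsP[i /eqP wi]] :
    has (fun s => [exists i, window (s := s) i == t]) D by rewrite has_count c1.
exists (tnth (in_tuple s) (ordS i)); first by rewrite -wi !inE eqxx orbT.
by apply/middleP; exists s, i; split=> //; apply: dec.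
Qed.

(** The window with middle vertex [a] has [b] at its beginning or at its end, so
the preceding or the following window is the triangle across [ab]. *)
Lemma middle_cross a b x y : tri a b x -> tri a b y -> x != y ->
  middle D [set a; b; x] a -> middle D [set a; b; y] b.
Proof.
move=> tx ty xy /middleP[s [i [sD sc wi ma]]].
have [_ win inj] := sc; apply/middleP; exists s.
have bs : b \in window i by rewrite wi !inE eqxx orbT.
have [ab ax bx] := tri_neq tx.
pose X := tnth (in_tuple s).
have wE j : window j = [set X j; X (ordS j); X (ordS (ordS j))] by [].
have next z : tri a b z -> [set a; b; z] != [set a; b; x] ->
    [set a; b; z] = [set a; b; y].
  move=> tz; rewrite eq_sym => zx; congr (_ :|: [set _]).
  by apply/esym; apply: (other_uniq surfK tx) => //; apply: contraNneq zx => ->.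
move: bs; rewrite wE !inE -/X -orbA => /or3P[]/eqP bX.
- exists (ord_pred i); rewrite ord_predK; split=> //.
  have wp : window (ord_pred i) = [set a; b; X (ord_pred i)].
    by rewrite wE ord_predK -bX -ma -set3_rot -set3_swapr.
  rewrite wp; apply: next; first by rewrite /tri -wp.
  rewrite -wp -wi; apply: contraNneq (ordS_neq (ord_pred i) sc) => /inj e.
  by rewrite ord_predK e.
- by rewrite bX /X ma eqxx in ab.
exists (ordS i); split=> //.
have wn : window (ordS i) = [set a; b; X (ordS (ordS (ordS i)))].
  by rewrite wE -bX -ma.
rewrite wn; apply: next; first by rewrite /tri -wn.
by rewrite -wn -wi; apply: contraNneq (ordS_neq i sc) => /inj ->.
Qed.

Lemma turning_of_decomposition : exists m, turning K m.
Proof.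
have [v _] := surface_vertex surfK.
pose m t := odflt v [pick a | middle D t a].
have mP t : t \in triangles K -> middle D t (m t).
  by rewrite /m => /middle_exists[a _ h]; case: pickP => [b|/(_ a)] //; rewrite h.
exists m; split=> [t tK|a b x y tx ty xy mx].
  by have [a at' h] := middle_exists tK; rewrite (middle_uniq tK (mP t tK) h).
apply: (middle_uniq ty (mP _ ty)); apply: (middle_cross tx ty xy).
by have := mP _ tx; rewrite mx.
Qed.

End MiddleOfDecomposition.

(** ** From turnings to 2-circuits *)

Section CircuitsOfTurning.
Variable m : {set V} -> V.
Hypothesis turnm : turning K m.

(** A triple stands for a triangle with a direction of travel through it, the
vertices being listed in the order of the visits; only the good ones, turning at
the middle vertex, occur on 2-circuits.  The map [step] fixes all others, so
that it is a permutation. *)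
Local Notation state := (V * V * V)%type.
Implicit Types (p q r : state).

Definition state_set q : {set V} := [set q.1.1; q.1.2; q.2].
Definition good q : bool := tri q.1.1 q.1.2 q.2 && (m (state_set q) == q.1.2).
Definition across a b c : V := odflt a [pick y | (y != a) && tri b c y].
Definition step q : state :=
  if good q then (q.1.2, q.2, across q.1.1 q.1.2 q.2) else q.
Definition rev_state q : state := (q.2, q.1.2, q.1.1).

Lemma acrossP a b c : tri a b c ->
  across a b c != a /\ tri b c (across a b c).
Proof.
rewrite tri_rot => /(tri_other surfK)[y [ay ty _]]; rewrite /across.
by case: pickP => [z /andP[]|/(_ y)] //=; rewrite eq_sym ay ty.
Qed.

Lemma rev_stateK : involutive rev_state.
Proof. by case=> [[a b] c]. Qed.

Lemma state_set_rev q : state_set (rev_state q) = state_set q.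
Proof. by rewrite /state_set /= -set3_rot set3_swapr. Qed.

Lemma good_rev q : good (rev_state q) = good q.
Proof. by rewrite /good state_set_rev /tri -/(state_set _) state_set_rev. Qed.

Lemma good_step q : good q -> good (step q).
Proof.
move=> gq; rewrite /step gq; case/andP: gq => /=.
case: q => [[a b] c] /= t; rewrite /state_set /= => /eqP mq.
have [ya ty] := acrossP t; rewrite /good /state_set /= ty /=; apply/eqP.
have t' : tri b c a by rewrite -tri_rot.
rewrite eq_sym in ya.
have [h _ _] := turning_cross turnm t' ty ya.
by apply: h; rewrite -set3_rot.
Qed.

(** The predecessor is reached by stepping in the reverse direction. *)
Lemma step_rev_step q : step (rev_state (step q)) = rev_state q.
Proof.
case gq: (good q); last by rewrite {2}/step gq /step good_rev gq.
have gs := good_step gq; rewrite {1}/step good_rev gs /step gq /=.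
case/andP: gq => + _; case: q gs => [[a b] c] /= gs t.
have [ya ty] := acrossP t; set y := across a b c in ya ty *.
have tyr : tri y c b by rewrite -tri_swapr tri_rot.
have [za tz] := acrossP tyr.
congr (_, _); apply/esym; apply: (other_uniq surfK _ _ tz ya) => //.
- by rewrite tri_swap.
- by rewrite tri_swap tri_rot tri_rot.
- by rewrite eq_sym.
Qed.

Lemma step_inj : injective step.
Proof.
move=> p q e; apply: (can_inj rev_stateK).
by rewrite -step_rev_step e step_rev_step.
Qed.

Lemma good_connect p q : fconnect step p q -> good p -> good q.
Proof.
by apply: (connect_invariant (P := good)) => a b /eqP <-; apply: good_step.
Qed.

Lemma rev_connect p q :
  fconnect step p q -> fconnect step (rev_state p) (rev_state q).
Proof.
move=> pq; apply: (connect_invariant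
  (P := fun q => fconnect step (rev_state p) (rev_state q)) _ pq) => //.
move=> a b /eqP <- pa; apply: connect_trans pa _.
by rewrite (fconnect_sym step_inj) -(step_rev_step a) fconnect1.
Qed.

(** A 2-circuit never runs through a triangle in both directions: in the middle
between the two passages it would have to turn around within a triangle or
across an edge. *)
Lemma no_reversal q : good q -> ~~ fconnect step q (rev_state q).
Proof.
move=> gq; apply/negP => /iter_findex; move: (findex _ _ _) => k.
elim/ltn_ind: k q gq => -[|[|k]] IH q gq e.
- have /andP[/tri_neq[_ + _] _] := gq.
  by rewrite {1}[q]e /= eqxx.
- have /andP[/tri_neq[_ _ +] _] := gq.
  by move: e; rewrite /= /step gq => -[-> _ _]; rewrite eqxx.
- apply: (IH k _ (step q) (good_step gq)) => //.
  by apply: step_inj; rewrite step_rev_step -e -iterS -iterSr.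
Qed.

Lemma state_set_inj p q : good p -> good q -> state_set p = state_set q ->
  q = p \/ q = rev_state p.
Proof.
move=> /andP[tp /eqP mp] /andP[tq /eqP mq] e.
have b : q.1.2 = p.1.2 by rewrite -mp -mq e.
have [ab ac bc] := tri_neq tq.
have qa : q.1.1 \in state_set p by rewrite e !inE eqxx.
have qc : q.2 \in state_set p by rewrite e !inE eqxx !orbT.
case: p q b {tp mp tq mq e} ab ac bc qa qc => [[a b] c] [[a' b'] c'] /= ->.
rewrite /state_set !inE /= ![_ == b]eq_sym => ab ac bc.
rewrite (negPf ab) (negPf bc) !orbF => /orP[]/eqP a'E /orP[]/eqP c'E;
  rewrite {}a'E {}c'E ?eqxx // in ac *; by [left|right].
Qed.

Definition circuit q : seq V := [seq p.1.1 | p <- orbit step q].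

Lemma size_circuit q : size (circuit q) = order step q.
Proof. by rewrite size_map size_orbit. Qed.

Lemma iter_mod_order n q : iter (n %% order step q) step q = iter n step q.
Proof.
rewrite {2}(divn_eq n (order step q)) addnC iterD; congr (iter _ step _).
elim: (_ %/ _)%N => //= k IH.
by rewrite mulSn iterD -IH (iter_order step_inj).
Qed.

Lemma window_circuit q (i : 'I_(size (circuit q))) : good q ->
  window i = state_set (iter i step q).
Proof.
move=> gq; have sz := size_circuit q.
have at_ (j : 'I_(size (circuit q))) n : j = (n %% size (circuit q))%N :> nat ->
    tnth (in_tuple (circuit q)) j = (iter n step q).1.1.
  move=> jn; have lt : (j < order step q)%N by rewrite -sz.
  rewrite (tnth_nth q.2) /= (nth_map q) ?size_orbit //.
  by rewrite nth_traject // jn sz iter_mod_order.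
rewrite /window (at_ _ i) ?modn_small // (at_ (ordS i) i.+1) //.
rewrite (at_ _ i.+2) /=; last by rewrite -addn1 modnDml addn1.
have gi : good (iter i step q) by apply: good_connect gq; apply: fconnect_iter.
have gS := good_step gi; rewrite /= in gS.
by rewrite [step (step _)]/step gS /= /step gi.
Qed.

Lemma two_circuit_circuit q : good q -> two_circuit K (circuit q).
Proof.
move=> gq; have gi i : good (iter i step q).
  by apply: good_connect gq; apply: fconnect_iter.
split.
- by rewrite -size_eq0 size_map size_orbit -lt0n order_gt0.
- by move=> i; rewrite window_circuit //; have /andP[] := gi i.
move=> i j; rewrite !window_circuit // => e; apply: val_inj => /=.
have lt (k : 'I_(size (circuit q))) : (k < order step q)%N.
  by rewrite -size_circuit.
have con k : fconnect step (iter k step q) q.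
  by rewrite (fconnect_sym step_inj) fconnect_iter.
case: (state_set_inj (gi i) (gi j) e) => e2.
  by rewrite -(findex_iter (lt i)) -(findex_iter (lt j)) e2.
case/negP: (no_reversal (gi i)); rewrite -e2.
by apply: connect_trans (con i) _; apply: fconnect_iter.
Qed.

Lemma circuit_meets q t : good q ->
  [exists i, window (s := circuit q) i == t] =
  [exists p, fconnect step q p && (state_set p == t)].
Proof.
move=> gq; apply/existsP/existsP => [[i]|[p /andP[qp pt]]].
  rewrite window_circuit // => it; exists (iter i step q).
  by rewrite fconnect_iter.
have lt : (findex step q p < size (circuit q))%N.
  by rewrite size_circuit findex_max.
by exists (Ordinal lt); rewrite window_circuit //= iter_findex.
Qed.

(** Each 2-circuit is the trace of two orbits of states, exchanged by reversal;
the numbering of the states serves to keep one of the two. *)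
Definition selected q : bool :=
  [&& good q, froot step q == q &
      (enum_rank q < enum_rank (froot step (rev_state q)))%N].

Lemma decomposition_of_turning : has_two_circuit_decomposition K.
Proof.
exists [seq circuit q | q <- enum {: state} & selected q]; split.
  move=> s /mapP[q]; rewrite mem_filter => /andP[/and3P[gq _ _] _] ->.
  exact: two_circuit_circuit.
move=> t tK; have csym := fconnect_sym step_inj.
have frootE p q : (froot step p == froot step q) = fconnect step p q.
  exact: (root_connect csym).
have [q0 g0 q0t] : exists2 q, good q & state_set q = t.
  have [mt _] := turnm; have [a [c tE]] := triangle_at tK (mt t tK).
  exists (a, m t, c); last by rewrite /state_set /= set3_swap -tE.
  by rewrite /good /state_set /tri /= set3_swap -tE tK eqxx.
wlog lt0 : q0 g0 q0t / (enum_rank (froot step q0) <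
                        enum_rank (froot step (rev_state q0)))%N.
  move=> wl; case: (ltngtP (enum_rank (froot step q0))
                           (enum_rank (froot step (rev_state q0)))) => h.
  - exact: wl h.
  - by apply: (wl (rev_state q0)); rewrite ?good_rev ?state_set_rev ?rev_stateK.
  - case/negP: (no_reversal g0); rewrite -frootE; apply/eqP.
    by apply: enum_rank_inj; apply: val_inj.
have root_rev q : froot step (rev_state (froot step q)) = froot step (rev_state q).
  by apply/eqP; rewrite frootE rev_connect // csym connect_root.
rewrite count_map count_filter.
rewrite (eq_count (a2 := pred1 (froot step q0))) => [|q] /=.
  by rewrite count_uniq_mem ?enum_uniq // mem_enum.
apply/andP/eqP => [[+ /and3P[gq /eqP rq lt]]|->].
  rewrite circuit_meets // => /existsP[p /andP[qp /eqP pt]].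
  have gp := good_connect qp gq.
  rewrite -rq; apply/eqP; rewrite frootE.
  case: (state_set_inj g0 gp); rewrite ?q0t // => pE; rewrite pE in qp => //.
  move: lt; rewrite -rq root_rev.
  have /eqP -> : froot step q == froot step (rev_state q0) by rewrite frootE.
  have /eqP -> : froot step (rev_state q) == froot step q0.
    by rewrite frootE -(rev_stateK q0) rev_connect.
  by rewrite ltnNge ltnW.
have c0 : fconnect step (froot step q0) q0 by rewrite csym connect_root.
have gr : good (froot step q0) by apply: good_connect g0; apply: connect_root.
split; last by rewrite /selected gr root_rev lt0 (root_root csym) eqxx.
by rewrite circuit_meets //; apply/existsP; exists q0; rewrite c0 q0t eqxx.
Qed.

End CircuitsOfTurning.

Lemma decomposition_turning :
  has_two_circuit_decomposition K <-> exists m, turning K m.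
Proof.
split=> [[D decD]|[m mK]]; first exact: turning_of_decomposition decD.
exact: decomposition_of_turning mK.
Qed.

End Turning.

(** * The obstruction on an oriented surface *)

Lemma Z3_3 : 3%:R = 0 :> 'Z_3.
Proof. exact: val_inj. Qed.

Section Oriented.
Variables (V : finType) (K : {set {set V}}).
Hypothesis surfK : closed_surface K.
Variable o : V -> V -> V -> bool.
Hypothesis orient : orientation K o.
Implicit Types (a b c u v w x y z : V) (t : {set V}).
Notation tri := (tri K).

Lemma pos_tri u v w : o u v w -> tri u v w.
Proof. by case: orient => h _ _ _; apply: h. Qed.

Lemma pos_rot u v w : o u v w -> o v w u.
Proof. by case: orient => _ h _ _; apply: h. Qed.

Lemma tri_pos u v w : tri u v w -> o u v w \/ o v u w.
Proof.
case: orient => _ _ h _ /h; case: (o u v w) => /=; first by left.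
by move=> /pos_rot/pos_rot; right.
Qed.

Lemma pos_swap u v w : o u v w -> o v u w = false.
Proof.
move=> ow; case: orient => _ _ h _; have := h _ _ _ (pos_tri ow); rewrite ow /=.
by move/negP => nh; apply/negP => /pos_rot.
Qed.

Lemma pos_inj u v w x : o u v w -> o u v x -> w = x.
Proof. by case: orient => _ _ _ h; apply: h. Qed.

Lemma edge_pos v w : edge K v w -> exists x, o v w x.
Proof.
move=> /(two_triangles surfK)[x [y [xy h]]].
have /tri_pos[|ox] : tri v w x by rewrite h eqxx.
  by exists x.
have /tri_pos[|oy] : tri v w y by rewrite h eqxx orbT.
  by exists y.
by rewrite (pos_inj ox oy) eqxx in xy.
Qed.

(** ** Angular coordinates *)

Local Notation cw := (cw_next o).

Lemma cw_nextE v x w : o v x w -> cw v w = x.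
Proof.
move=> ox; rewrite /cw_next; case: pickP => [y oy|/(_ x)] /=; last by rewrite ox.
exact: pos_inj (pos_rot (pos_rot oy)) (pos_rot (pos_rot ox)).
Qed.

Lemma cw_next_pos v w : edge K v w -> o v (cw v w) w.
Proof.
rewrite edgeC => /edge_pos[x /pos_rot ox]; have := cw_nextE ox.
by move=> ->.
Qed.

Lemma pos_edges v x w : o v x w -> edge K v x /\ edge K v w.
Proof.
move=> /pos_tri t; split; apply: (tri_edge surfK); first exact: t.
by rewrite tri_swapr; apply: t.
Qed.

Lemma cw_next_edge v w : edge K v (cw v w) = edge K v w.
Proof.
case vw: (edge K v w); first by have [] := pos_edges (cw_next_pos vw).
rewrite /cw_next; case: pickP => [x /pos_edges[_]|_] /=; by rewrite vw.
Qed.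

Lemma cw_next_inj v : injective (cw v).
Proof.
move=> a b e; have [va|va] := boolP (edge K v a).
  have vb : edge K v b by rewrite -cw_next_edge -e cw_next_edge.
  by apply: (pos_inj (cw_next_pos va)); rewrite e; apply: cw_next_pos.
have vb : ~~ edge K v b by rewrite -cw_next_edge -e cw_next_edge.
have out w : ~~ edge K v w -> cw v w = w.
  by rewrite /cw_next; case: pickP => // x /pos_edges[_ ->].
by rewrite -(out a va) e out.
Qed.

Lemma cw_next_connect v a b : edge K v a -> fconnect (cw v) a b = edge K v b.
Proof.
move=> va; apply/idP/idP => [ab|vb].
  apply: (connect_invariant (P := edge K v)) ab va => x y /eqP <-.
  by rewrite cw_next_edge.
apply: connect_sub (link_connect surfK va vb) => x y.
rewrite link_edge // => /tri_pos t.
case: t => [/cw_nextE <-|/pos_rot/cw_nextE <-].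
  by rewrite (fconnect_sym (@cw_next_inj v)) fconnect1.
exact: fconnect1.
Qed.

(** The edges of the link, each given by its clockwise start, correspond to the
triangles at [v]. *)
Lemma order_cw_next v a : edge K v a -> order (cw v) a = valence K v.
Proof.
move=> va; rewrite /order /valence.
rewrite (@eq_card _ _ (edge K v)) => [|b]; last exact: cw_next_connect.
rewrite -(card_in_imset (f := fun w => [set v; cw v w; w])).
  apply: eq_card => t; apply/imsetP/idP => [[w vw ->]|].
    rewrite inE !in_setU set11 andbT; exact: pos_tri (cw_next_pos vw).
  rewrite inE => /andP[tK vt]; have [x [w tE]] := triangle_at tK vt.
  rewrite tE in tK *; case: (tri_pos tK) => [ox|/pos_rot ow].
    exists w; first by case: (pos_edges ox).
    by rewrite (cw_nextE ox).
  exists x; first by case: (pos_edges ow).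
  by rewrite (cw_nextE ow) set3_swapr.
move=> x y vx vy e; apply/eqP; apply: contraT => xy.
have ox := cw_next_pos vx; have oy := cw_next_pos vy.
have [vcx vx' _] := tri_neq (pos_tri ox); have [vcy vy' _] := tri_neq (pos_tri oy).
have yE : y = cw v x.
  have /setP/(_ y) := e; rewrite !inE eqxx orbT !(eq_sym y) (negPf vy').
  by rewrite (negPf xy) orbF /= => /eqP.
have xE : x = cw v y.
  have /setP/(_ x) := e; rewrite !inE eqxx orbT !(eq_sym x) (negPf vx').
  by rewrite eq_sym in xy; rewrite eq_sym (negPf xy) orbF /= => /esym/eqP.
rewrite -yE in ox; rewrite -xE in oy.
by have := pos_swap (pos_rot (pos_rot oy)); rewrite ox.
Qed.

(** [f v] measures, mod 3, the clockwise angle in the link of [v]: the clockwise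
successor of [w] there is the [x] with [o v x w]. *)
Definition angular_coordinate (f : V -> V -> 'Z_3) : Prop :=
  forall v x w, o v x w -> f v x = f v w + 1.

(** Counting clockwise steps from a base point of the link is consistent mod 3
after a full turn, whose length is the valence. *)
Lemma angular_coordinate_exists :
  three_divisible K -> exists f, angular_coordinate f.
Proof.
move=> divK.
pose base v := odflt v [pick w | edge K v w].
have baseP v w : edge K v w -> edge K v (base v).
  by rewrite /base; case: pickP => //= /(_ w) ->.
exists (fun v w => (findex (cw v) (base v) w)%:R) => v x w ox.
have [vx vw] := pos_edges ox; have vb := baseP _ _ vw.
have bw : fconnect (cw v) (base v) w by rewrite cw_next_connect.
rewrite natr1 -(cw_nextE ox) -[in LHS](iter_findex bw) -iterS.
have := findex_max bw; rewrite leq_eqVlt => /orP[/eqP e|lt].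
  rewrite e iter_order ?findex0; last exact: cw_next_inj.
  rewrite order_cw_next //; have /dvdnP[k ->] := divK v.
  by rewrite natrM Z3_3 mulr0.
by rewrite findex_iter.
Qed.

(** Each clockwise step raises an angular coordinate by 1. *)
Lemma angle_coordinate f u v w : angular_coordinate f ->
  edge K v u -> edge K v w -> (angle o (u, v) (v, w))%:R = f v u - f v w.
Proof.
move=> fP vu vw; rewrite /angle /=.
have wu : fconnect (cw v) w u by rewrite cw_next_connect.
rewrite -[in RHS](iter_findex wu); move: (findex _ _ _) => n.
elim: n => [|n IH] /=; first by rewrite subrr.
have vn : edge K v (iter n (cw v) w).
  by rewrite -(cw_next_connect _ vw) fconnect_iter.
by rewrite (fP _ _ _ (cw_next_pos vn)) -natr1 IH addrAC.
Qed.

Definition turn_cochain (f : V -> V -> 'Z_3) (e : V * V) : 'Z_3 :=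
  f e.2 e.1 - f e.1 e.2.

(** At the vertex [v] between the edges [uv] and [vw] the angle is
[f v u - f v w]; regrouping these terms by edges instead of vertices turns the
sum of the angles into a sum of a cochain. *)
Lemma theta_path_cochain f v0 p : angular_coordinate f -> closed_path K v0 p ->
  (theta_path o v0 p)%:R = \sum_(e <- path_edges v0 p) turn_cochain f e.
Proof.
move=> fP; rewrite /theta_path /closed_path natr_sum.
case: p => [|x p] /=; first by rewrite !big_nil.
(* The closing edge [e0] is kept apart to allow induction over open paths. *)
have sum (e0 : V * V) y v q :
    edge K v y -> path (edge K) v q -> last v q = e0.1 -> edge K e0.1 e0.2 ->
    \sum_(ee <- zip ((y, v) :: path_edges v q) (rcons (path_edges v q) e0))
       (angle o ee.1 ee.2)%:R =
    f v y + \sum_(e <- path_edges v q) turn_cochain f e - f e0.1 e0.2.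
  elim: q y v => [|z q IH] y v vy /=.
    case: e0 => a b _ /= <- vb.
    by rewrite big_cons !big_nil !addr0 (angle_coordinate fP).
  move=> /andP[vz zq] lz e0e; rewrite !big_cons -/(path_edges z q).
  rewrite IH //= 1?edgeC // (angle_coordinate fP) // /turn_cochain /=.
  by ring.
move=> /andP[/andP[vx xp] /eqP lx]; rewrite rot1_cons -/(path_edges x p).
by rewrite (sum (v0, x)) //= 1?edgeC // big_cons /turn_cochain /=; ring.
Qed.

(** On a positive triangle each of the three corners contributes the same unit
angle, and these add up to 3. *)
Lemma turn_cochain_cocycle f : angular_coordinate f ->
  [ffun e => if edge K e.1 e.2 then turn_cochain f e else 0]
    \in cocycle1_pred K.
Proof.
move=> fP; pose c (e : V * V) := if edge K e.1 e.2 then turn_cochain f e else 0.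
have alt u v : c (v, u) = - c (u, v).
  by rewrite /c /= edgeC /turn_cochain /=; case: ifP; rewrite ?oppr0 // opprB.
have pos u v w : o u v w -> c (u, v) + c (v, w) + c (w, u) = 0.
  move=> ou; have ov := pos_rot ou; have ow := pos_rot ov.
  have [_ uw] := pos_edges ou; have [_ vu] := pos_edges ov.
  have [_ wv] := pos_edges ow.
  rewrite /c /= edgeC vu edgeC wv edgeC uw /turn_cochain /=.
  rewrite (fP _ _ _ ou) (fP _ _ _ ov) (fP _ _ _ ow) -[RHS]oppr0 -Z3_3.
  by ring.
apply/cocycle1P; split=> [u v|u v nuv|u v w t]; rewrite !ffunE.
- exact: alt.
- by rewrite (negPf nuv).
rewrite -!/(c (_, _)); case: (tri_pos t) => [/pos //|/pos e].
by rewrite -[RHS]oppr0 -e (alt v u) (alt w v) (alt u w); ring.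
Qed.

Definition edge_symmetric (f : V -> V -> 'Z_3) : Prop :=
  forall u v, edge K u v -> f u v = f v u.

Lemma theta_class_coordinate f v0 : three_divisible K -> angular_coordinate f ->
  theta_class K o v0 = 0 <->
  exists g : V -> 'Z_3, forall u v, edge K u v ->
    turn_cochain f (u, v) = g v - g u.
Proof.
move=> divK fP; pose c := Cocycle1 (turn_cochain_cocycle fP).
have -> : theta_class K o v0 = (\pi_(H1_Z3 K) c)%qT.
  apply: (corresponds_to_theta_inj surfK); first exact: theta_classP.
  move=> p pP; rewrite H1_evalE // (theta_path_cochain fP pP).
  apply: eq_big_seq => e ep; rewrite ffunE.
  by case/andP: pP => /mem_path_edges/(_ ep) ->.
have -> : (\pi_(H1_Z3 K) c)%qT = 0 <-> c \in @coboundary1 _ K.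
  rewrite -[c in c \in _]subr0 Quotient.idealrBE raddf0; split=> /eqP //.
split=> [/coboundary1P[g gP]|[g gP]].
  by exists g => u v uv; rewrite -gP // ffunE uv.
by apply/coboundary1P; exists [ffun v => g v] => u v uv; rewrite !ffunE uv gP.
Qed.

(** The angular coordinates at the vertices are unique up to constants [g v], and
[theta] vanishes when these can be chosen so that the two coordinates of every
edge agree. *)
Lemma theta_class_eq0 v0 : three_divisible K ->
  theta_class K o v0 = 0 <->
  exists2 f, angular_coordinate f & edge_symmetric f.
Proof.
move=> divK; split=> [th|[f fP fsym]]; last first.
  apply/(theta_class_coordinate v0 divK fP); exists (fun=> 0) => u v uv.
  by rewrite /turn_cochain /= (fsym u v) // !subrr.
have [f fP] := angular_coordinate_exists divK.
have [g gP] := (theta_class_coordinate v0 divK fP).1 th.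
exists (fun u v => f u v - g u) => [v x w ox|u v uv].
  by rewrite (fP _ _ _ ox) addrAC.
have := gP u v uv; rewrite /turn_cochain /= => e.
by rewrite -[f v u](subrK (f u v)) e; ring.
Qed.

End Oriented.

Lemma Z3_cases (i : 'Z_3) : [\/ i = 0, i = 1 | i = -1].
Proof.
by case: i => -[|[|[|i]]] // h; [constructor 1|constructor 2|constructor 3];
  apply: val_inj.
Qed.

Section Labelling.
Variables (V : finType) (K : {set {set V}}).
Hypothesis surfK : closed_surface K.
Variable o : V -> V -> V -> bool.
Hypothesis orient : orientation K o.
Implicit Types (a b c u v w x y z : V) (t : {set V}).
Notation tri := (tri K).

(** ** Symmetric angular coordinates and turnings *)

Section TurningsOfCoordinate.
Variable f : V -> V -> 'Z_3.
Hypotheses (fP : angular_coordinate o f) (fsym : edge_symmetric K f).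

Lemma coordinate_rot u v w : o u v w -> f v w = f u v + 1.
Proof.
move=> ow; have ov := pos_rot orient ow; have [vw vu] := pos_edges surfK orient ov.
by rewrite (fP ov) (fsym vu).
Qed.

Lemma label_inj a b c : tri a b c -> f a b != f b c.
Proof.
have pos u v w : o u v w -> f u v != f v w.
  by move=> /coordinate_rot ->; rewrite -subr_eq0 opprD addrA subrr add0r.
move=> t; have ab := tri_edge surfK t; have bc : edge K b c.
  by apply: (tri_edge surfK (c := a)); rewrite -tri_rot.
case/(tri_pos orient): t => [/pos //|/(pos_rot orient)/(pos_rot orient)/pos].
by rewrite -(fsym ab) -(fsym bc) eq_sym.
Qed.

Lemma label_surj a b c k : tri a b c -> [\/ f a b = k, f b c = k | f c a = k].
Proof.
have pos u v w : o u v w -> [\/ f u v = k, f v w = k | f w u = k].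
  move=> ou; have ov := pos_rot orient ou.
  rewrite (coordinate_rot ov) (coordinate_rot ou).
  case: (Z3_cases (k - f u v)) => /eqP; rewrite subr_eq => /eqP->.
  - by constructor 1; rewrite add0r.
  - by constructor 2; rewrite addrC.
  - by constructor 3; rewrite -[-1]add0r -Z3_3; ring.
move=> t; have ab := tri_edge surfK t; have bc : edge K b c.
  by apply: (tri_edge surfK (c := a)); rewrite -tri_rot.
have ca : edge K c a by apply: (tri_edge surfK (c := b)); rewrite tri_rot.
case/(tri_pos orient): t => [/pos //|/pos].
rewrite -(fsym ab) -(fsym bc) -(fsym ca).
by case; [constructor 1|constructor 3|constructor 2].
Qed.

(** The positive orientations of the two triangles traverse [ab] in opposite
directions, which exchanges the roles of [a] and [b]. *)
Lemma label_across a b x y : tri a b x -> tri a b y -> x != y -> f b x = f a y.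
Proof.
have pos u v p q : o u v p -> o v u q -> f v p = f u q.
  move=> op oq; rewrite (coordinate_rot op) (coordinate_rot oq).
  by rewrite (fsym (tri_edge surfK (pos_tri orient op))).
have cross u v p q : o u v p -> o v u q -> f u p = f v q.
  move=> op oq; have up := pos_rot orient op; have uq := pos_rot orient oq.
  have [_ e1] := pos_edges surfK orient op; have [_ e2] := pos_edges surfK orient oq.
  by rewrite (fsym e1) (fsym e2) (coordinate_rot up) (coordinate_rot uq) (pos u v p q).
move=> /(tri_pos orient)[ox|ox] /(tri_pos orient)[oy|oy] xy.
- by rewrite (pos_inj orient ox oy) eqxx in xy.
- exact: pos ox oy.
- exact: cross ox oy.
- by rewrite (pos_inj orient ox oy) eqxx in xy.
Qed.

(** In each triangle the three labels occur once each on its edges; so the label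
[k] selects an edge, and with it the vertex off that edge. *)
Definition opposite_label k t z : bool :=
  [exists a in t, exists b in t, [&& z != a, z != b, a != b & f a b == k]].

Definition opposite_vertex (v0 : V) (k : 'Z_3) t : V :=
  odflt v0 [pick z in t | opposite_label k t z].

Lemma opposite_labelE k z a b : tri z a b ->
  opposite_label k [set z; a; b] z = (f a b == k).
Proof.
move=> t; have [za zb ab] := tri_neq t.
have eab : edge K a b by apply: (tri_edge surfK (c := z)); rewrite -tri_rot.
apply/exists_inP/idP => [[p + /exists_inP[q]]|fk]; last first.
  exists a; first by rewrite !inE eqxx orbT.
  apply/exists_inP; exists b; first by rewrite !inE eqxx !orbT.
  by rewrite za zb ab.
rewrite !inE -!orbA => /or3P[]/eqP-> /or3P[]/eqP->; rewrite ?eqxx ?andbF //.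
  by case/and4P.
by rewrite -(fsym eab) => /and4P[].
Qed.

Lemma opposite_vertexP v0 k z a b : tri z a b ->
  (opposite_vertex v0 k [set z; a; b] == z) = (f a b == k).
Proof.
move=> t; rewrite -(opposite_labelE k t) /opposite_vertex.
have t' := t; rewrite tri_rot in t'; have t'' := t'; rewrite tri_rot in t''.
have lz := opposite_labelE k t.
have la : opposite_label k [set z; a; b] a = (f b z == k).
  by rewrite -(opposite_labelE k t') [in LHS]set3_rot.
have lb : opposite_label k [set z; a; b] b = (f z a == k).
  by rewrite -(opposite_labelE k t'') [in RHS]set3_rot.
case: pickP => [x /andP[xt lx]|none] /=; last first.
  have := none z; have := none a; have := none b.
  rewrite la lb lz !inE !eqxx ?orbT /= => /eqP ha /eqP hb /eqP hc.
  by case: (label_surj k t).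
move: xt lx; rewrite !inE -orbA => /or3P[]/eqP->.
- by rewrite eqxx.
- have [za _ _] := tri_neq t; rewrite la lz [a == z]eq_sym (negPf za) => /eqP <-.
  by apply/esym/negbTE; apply: label_inj.
have [_ zb _] := tri_neq t; rewrite lb lz [b == z]eq_sym (negPf zb) => /eqP <-.
by apply/esym/negbTE; rewrite eq_sym; apply: label_inj.
Qed.

Lemma opposite_vertex_turning v0 k : turning K (opposite_vertex v0 k).
Proof.
split=> [t tK|a b x y tx ty xy /eqP].
  have [z zt] := triangle_vertex tK.
  have [a [b tE]] := triangle_at tK zt; rewrite tE in tK *.
  case: (label_surj k tK) => /eqP h.
  - have tb : tri b z a by rewrite -/(tri _ _ _) tri_rot.
    move: h; rewrite -(opposite_vertexP v0 k tb) set3_rot => /eqP ->.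
    by rewrite !inE eqxx orbT.
  - move: h; rewrite -(opposite_vertexP v0 k tK) => /eqP ->.
    by rewrite !inE eqxx.
  - have ta : tri a b z by rewrite -tri_rot.
    move: h; rewrite -(opposite_vertexP v0 k ta) -set3_rot => /eqP ->.
    by rewrite !inE eqxx orbT.
rewrite opposite_vertexP // (label_across tx ty xy) set3_swap => e.
by apply/eqP; rewrite opposite_vertexP // -tri_swap.
Qed.

End TurningsOfCoordinate.
(** The label of an edge records the position of the turning in a triangle on
it, relative to this edge. *)
Definition label_of_turning (m : {set V} -> V) u v : 'Z_3 :=
  if [pick x | o u v x] is Some x then
    if m [set u; v; x] == x then 0 else
    if m [set u; v; x] == u then -1 else 1
  else 0.

Lemma coordinate_of_turning m : turning K m ->
  angular_coordinate o (label_of_turning m) /\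
  edge_symmetric K (label_of_turning m).
Proof.
move=> mK.
have labelE u v x : o u v x -> label_of_turning m u v =
    if m [set u; v; x] == x then 0 else
    if m [set u; v; x] == u then -1 else 1.
  rewrite /label_of_turning => ox; case: pickP => [y oy|/(_ x)]; last by rewrite ox.
  by rewrite (pos_inj orient oy ox).
have sym : edge_symmetric K (label_of_turning m).
  move=> u v uv; have [x ox] := edge_pos surfK orient uv.
  have [y oy] : exists y, o v u y by apply: (edge_pos surfK orient); rewrite edgeC.
  have xy : x != y.
    by apply: contraFneq (pos_swap orient ox) => ->.
  have tx := pos_tri orient ox; have ty := pos_tri orient oy.
  have [uv' ux vx] := tri_neq tx; have [vu vy uy] := tri_neq ty.
  rewrite (labelE _ _ _ ox) (labelE _ _ _ oy) [in RHS]set3_swap.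
  rewrite tri_swap in ty; have [h1 h2 h3] := turning_cross mK tx ty xy.
  case: (turning_mem mK tx) => mx.
  - by rewrite (h1 mx) mx (negPf ux) (negPf vy) !eqxx.
  - by rewrite (h2 mx) mx (negPf vx) (negPf uy) eq_sym (negPf uv').
  - by rewrite (h3 mx) mx !eqxx.
split=> // v x w ox.
have ow := pos_rot orient (pos_rot orient ox).
have [vx vw xw] := tri_neq (pos_tri orient ox).
have [_ evw] := pos_edges surfK orient ox.
rewrite (sym v w) // (labelE _ _ _ ox) (labelE _ _ _ ow).
rewrite -[in LHS]set3_rot.
have [wv wx _] := tri_neq (pos_tri orient ow).
case: (turning_mem mK (pos_tri orient ow)) => ->; rewrite ?eqxx.
- by rewrite (negPf wx) addrC subrr.
- rewrite (negPf vw) (negPf vx).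
  by apply: val_inj.
- by rewrite ![x == _]eq_sym (negPf wx) (negPf vx) add0r.
Qed.

End Labelling.

(** * Double covers *)

Section Cover.
Variables (V W : finType) (K : {set {set V}}) (L : {set {set W}}) (p : W -> V).
Hypotheses (surfK : closed_surface K) (surfL : closed_surface L).
Hypothesis covp : double_cover K L p.
Implicit Types (a b c u v w x y z : W) (s t : {set W}).

Lemma cover_inj t : t \in L -> {in t &, injective p}.
Proof. by case: covp => h _ /h[]. Qed.

Lemma cover_simplex t : t \in L -> p @: t \in K.
Proof. by case: covp => h _ /h[]. Qed.

Lemma lift_uniq s t u : s \in L -> t \in L -> p @: s = p @: t ->
  u \in s -> u \in t -> s = t.
Proof.
move=> sL tL e us ut; have [_ /(_ _ (cover_simplex sL)) [_ /and3P[_ triv _]]] := covp.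
apply: contraTeq isT => st.
have /trivIsetP/(_ s t) := triv; rewrite !inE sL tL e eqxx => /(_ isT isT st).
by move=> /disjoint_setI0/setP/(_ u); rewrite !inE us ut.
Qed.

Lemma lift_ex (s : {set V}) u : s \in K -> p u \in s ->
  exists t, [/\ t \in L, p @: t = s & u \in t].
Proof.
move=> sK us; have [_ /(_ s sK) [_ /and3P[/eqP cov _ _]]] := covp.
have : u \in p @^-1: s by rewrite inE.
rewrite -cov => /bigcupP[t]; rewrite inE => /andP[tL /eqP tp] ut.
by exists t.
Qed.

Lemma imset_set3 (T T' : finType) (g : T -> T') d e f :
  g @: [set d; e; f] = [set g d; g e; g f].
Proof. by rewrite !imsetU !imset_set1. Qed.

Lemma card_lift t : t \in L -> #|p @: t| = #|t|.
Proof. by move=> /cover_inj/card_in_imset. Qed.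

Lemma cover_triangle t : t \in triangles L -> p @: t \in triangles K.
Proof.
by rewrite !inE => /andP[tL t3]; rewrite cover_simplex // card_lift.
Qed.

Lemma cover_tri a b c : tri L a b c -> tri K (p a) (p b) (p c).
Proof. by rewrite /tri -imset_set3; apply: cover_triangle. Qed.

(** Two lifts of an edge from one point meet, while the lifts of a simplex are
disjoint. *)
Lemma lift_edge_uniq a b b' : edge L a b -> edge L a b' -> p b = p b' -> b = b'.
Proof.
move=> /andP[ab tL] /andP[ab' tL'] e.
have /setP/(_ b) : [set a; b] = [set a; b'].
  apply: (lift_uniq (u := a)) => //; rewrite ?inE ?eqxx //.
  by rewrite !imsetU !imset_set1 e.
by rewrite !inE eqxx orbT eq_sym (negPf ab) => /esym/eqP.
Qed.

Lemma triangle_lift (s : {set V}) u : s \in triangles K -> p u \in s ->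
  exists t, [/\ t \in triangles L, p @: t = s & u \in t].
Proof.
rewrite inE => /andP[sK s3] /(lift_ex sK)[t [tL tp ut]]; exists t; split=> //.
by rewrite inE tL -card_lift // tp s3.
Qed.

Lemma tri_lift a (y z : V) : tri K (p a) y z ->
  exists b c, [/\ tri L a b c, p b = y & p c = z].
Proof.
move=> t; have pa : p a \in [set p a; y; z] by rewrite !inE eqxx.
have [s [sL sp /(triangle_at sL)[b [c sE]]]] := triangle_lift t pa.
have tabc : tri L a b c by rewrite /tri -sE.
have [py pz yz] := tri_neq t; have [pb pc pbc] := tri_neq (cover_tri tabc).
rewrite sE imset_set3 in sp.
have /setP/(_ y) := sp; have /setP/(_ z) := sp.
rewrite !inE !eqxx !orbT ![_ == p a]eq_sym (negPf py) (negPf pz) /=.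
move=> /orP[]/eqP zE /orP[]/eqP yE; first by rewrite zE yE eqxx in yz.
  by exists c, b; rewrite tri_swapr.
  by exists b, c.
by rewrite zE yE eqxx in yz.
Qed.

(** The triangles at a vertex correspond to those at its image, since a
triangle has exactly one lift at a given point above it. *)
Lemma valence_cover w : valence L w = valence K (p w).
Proof.
rewrite /valence -(card_in_imset (f := fun t => p @: t)).
  apply: eq_card => s; apply/imsetP/idP => [[t]|].
    by rewrite inE => /andP[tL wt] ->; rewrite inE cover_triangle // imset_f.
  rewrite inE => /andP[sK ws]; have [t [tL tp wt]] := triangle_lift sK ws.
  by exists t; rewrite // inE tL.
move=> s t; rewrite !inE => /andP[/andP[sL _] ws] /andP[/andP[tL _] wt] e.
exact: lift_uniq e ws wt.
Qed.

Lemma three_divisible_cover : three_divisible K -> three_divisible L.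
Proof. by move=> divK w; rewrite valence_cover. Qed.

Lemma turning_pullback m : turning K m -> exists m', turning L m'.
Proof.
move=> mK; have [w0 _] := surface_vertex surfL.
pose m' t := odflt w0 [pick u in t | p u == m (p @: t)].
have m'P t : t \in triangles L -> m' t \in t /\ p (m' t) = m (p @: t).
  move=> tL; rewrite /m'; case: pickP => [u /andP[ut /eqP] //|none].
  have [/(_ _ (cover_triangle tL)) /imsetP[u ut e] _] := mK.
  by have := none u; rewrite ut e eqxx.
exists m'; split=> [t /m'P[] //|a b x y tx ty xy mx].
have txy : p x != p y.
  apply: contraNneq xy => e; apply/eqP; apply: (lift_edge_uniq (a := a)) e.
    by apply: (tri_edge surfL (c := b)); rewrite tri_swapr.
  by apply: (tri_edge surfL (c := b)); rewrite tri_swapr.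
have [_ pmx] := m'P _ tx; have [my pmy] := m'P _ ty.
have [_ cross] := mK.
have /cross : tri K (p a) (p b) (p x) by apply: cover_tri.
move=> /(_ (p y) (cover_tri ty) txy); rewrite -!imset_set3 -pmx -pmy mx.
move=> /(_ erefl); apply: (cover_inj (t := [set a; b; y])) => //.
  by move: ty; rewrite triE => /andP[].
by rewrite !inE eqxx orbT.
Qed.

(** ** The deck transformation *)

Definition deck w : W := odflt w [pick u | (p u == p w) && (u != w)].

Lemma deckP w : [/\ p (deck w) = p w, deck w != w &
  forall u, p u = p w -> u = w \/ u = deck w].
Proof.
have pwK : [set p w] \in K by rewrite -imset_set1 cover_simplex // vertex_mem.
have [_ /(_ _ pwK) [card2 _]] := covp.
have fiber : #|[set u | p u == p w]| = 2%N.
  rewrite -card2 -(card_imset _ set1_inj); apply: eq_card => t.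
  apply/imsetP/idP => [[u + ->]|].
    by rewrite !inE imset_set1 => /eqP ->; rewrite vertex_mem //=.
  rewrite inE => /andP[tL /eqP tp].
  have /cards1P[u tu] : #|t| == 1%N by rewrite -card_lift // tp cards1.
  exists u; rewrite // inE; apply/eqP/set1P.
  by rewrite -tp tu imset_f // inE.
have /cards1P[x xE] : #|[set u | p u == p w] :\ w| == 1%N.
  by move/eqP: fiber; rewrite (cardsD1 w) !inE eqxx.
have fE u : (u != w) && (p u == p w) = (u == x).
  by have /setP/(_ u) := xE; rewrite !inE.
have dE : deck w = x.
  rewrite /deck; case: pickP => [u|/(_ x)]; rewrite andbC fE ?eqxx //.
  by move=> /eqP.
have := fE x; rewrite eqxx => /andP[xw /eqP px]; rewrite dE; split=> // u pu.
have [|uw] := eqVneq u w; first by left.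
by right; apply/eqP; rewrite -fE uw pu eqxx.
Qed.

Lemma p_deck w : p (deck w) = p w.
Proof. by have [] := deckP w. Qed.

Lemma deckK : involutive deck.
Proof.
move=> w; have [pd dw h] := deckP w; have [pdd ddw _] := deckP (deck w).
case: (h (deck (deck w))) => [|//|e]; first by rewrite pdd.
by rewrite e eqxx in ddw.
Qed.

(** The other lift of an edge has both ends different: a common end would give
two lifts from one point. *)
Lemma deck_edge a b b' : edge L a b -> edge L (deck a) b' -> p b' = p b ->
  b' = deck b.
Proof.
move=> ab ab' e; have [_ da _] := deckP a; have [_ _ /(_ b' e)] := deckP b.
case=> // bE; rewrite bE edgeC in ab'; rewrite edgeC in ab.
by rewrite (lift_edge_uniq ab' ab (p_deck a)) eqxx in da.
Qed.

Lemma deck_tri a b c : tri L a b c -> tri L (deck a) (deck b) (deck c).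
Proof.
move=> t; have := cover_tri t; rewrite -(p_deck a) => /tri_lift.
move=> [b' [c' [t' pb pc]]].
rewrite -(deck_edge (tri_edge surfL t) (tri_edge surfL t') pb).
rewrite tri_swapr in t; have t'' := t'; rewrite tri_swapr in t''.
by rewrite -(deck_edge (tri_edge surfL t) (tri_edge surfL t'') pc).
Qed.

Lemma deck_triangle t : t \in triangles L -> deck @: t \in triangles L.
Proof.
move=> tL; have [z zt] := triangle_vertex tL.
have [a [b tE]] := triangle_at tL zt; rewrite tE imset_set3; apply: deck_tri.
by rewrite /tri -tE.
Qed.

Lemma deck_imsetK t : deck @: (deck @: t) = t.
Proof.
rewrite -imset_comp (eq_imset (g := id)) ?imset_id // => w /=.
exact: deckK.
Qed.

Lemma p_deck_imset t : p @: (deck @: t) = p @: t.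
Proof. by rewrite -imset_comp; apply: eq_imset => w /=; apply: p_deck. Qed.

Lemma lift_deck s t : s \in triangles L -> t \in triangles L ->
  p @: s = p @: t -> s = t \/ s = deck @: t.
Proof.
move=> sL tL e; have [u us] := triangle_vertex sL.
have : p u \in p @: t by rewrite -e imset_f.
have inL r : r \in triangles L -> r \in L by rewrite inE => /andP[].
move=> /imsetP[w wt pu]; have [_ _ /(_ u pu)] := deckP w.
case=> uE; rewrite uE in us; [left|right].
  by apply: lift_uniq us wt => //; apply: inL.
apply: lift_uniq us _; rewrite ?inL ?deck_triangle ?p_deck_imset //.
exact: imset_f.
Qed.

(** The conjugate of a turning by the deck transformation. *)
Definition deck_twist (m : {set W} -> W) t : W := deck (m (deck @: t)).

Lemma deck_twist_turning m : turning L m -> turning L (deck_twist m).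
Proof.
move=> [mem cross]; split=> [t tL|a b x y tx ty xy].
  by have := imset_f deck (mem _ (deck_triangle tL)); rewrite deck_imsetK.
rewrite /deck_twist !imset_set3 => mx.
rewrite (cross (deck a) (deck b) (deck x)) ?deckK ?deck_tri //.
  by rewrite (inj_eq (can_inj deckK)).
by rewrite -[LHS]deckK mx.
Qed.

(** Invariance makes the projection of the turning independent of the lift. *)
Lemma turning_pushforward m : turning L m ->
  {in triangles L, deck_twist m =1 m} -> exists m', turning K m'.
Proof.
move=> [mem cross] inv.
have [v0 _] := surface_vertex surfK.
pose m' (s : {set V}) :=
  odflt v0 (omap (fun t => p (m t)) [pick t in triangles L | p @: t == s]).
have m'E t : t \in triangles L -> m' (p @: t) = p (m t).
  rewrite /m' => tL; case: pickP => [s /andP[sL /eqP e]|/(_ t)] /=; last first.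
    by rewrite tL eqxx.
  have [->//|->] := lift_deck sL tL e.
  by rewrite -(inv t tL) /deck_twist p_deck.
have above (v : V) : exists w, p w = v.
  have [_ /(_ _ (vertex_mem surfK v)) [+ _]] := covp.
  have [->|/set0Pn[t]] := eqVneq [set t in L | p @: t == [set v]] set0.
    by rewrite cards0.
  rewrite inE => /andP[_ /eqP tp] _.
  by have /imsetP[w _ ->] : v \in p @: t by [rewrite tp inE]; exists w.
exists m'; split=> [s sK|a b x y].
  have [v vs] := triangle_vertex sK.
  have [w pw] := above v; rewrite -pw in vs.
  have [t [tL <- _]] := triangle_lift sK vs.
  by rewrite m'E // imset_f // mem.
have [a' <-] := above a => /tri_lift[b' [x' [tx <- <-]]].
move=> /tri_lift[b'' [y' [ty bb <-]]] xy.
have bE : b'' = b'.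
  by apply: lift_edge_uniq bb; apply: (tri_edge surfL); eassumption.
rewrite {}bE in ty; rewrite -!imset_set3 !m'E // => pmx.
congr (p _); apply: (cross _ _ _ _ tx ty); first by apply: contraNneq xy => ->.
apply: (cover_inj (t := [set a'; b'; x'])) pmx; rewrite ?mem //.
  by move: tx; rewrite triE => /andP[].
by rewrite !inE eqxx.
Qed.

End Cover.

Lemma involution_Z3_fixed (g : 'Z_3 -> 'Z_3) : involutive g -> exists k, g k = k.
Proof.
move=> gK; case: (Z3_cases (g 0)) => g0; first by exists 0.
  exists (-1); have g1 := gK 0; rewrite g0 in g1.
  by case: (Z3_cases (g (-1))) (gK (-1)) => // ->; rewrite ?g0 ?g1.
exists 1; have g1 := gK 0; rewrite g0 in g1.
by case: (Z3_cases (g 1)) (gK 1) => // ->; rewrite ?g0 ?g1.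
Qed.

(** The deck transformation permutes the three turnings given by a symmetric
angular coordinate; being an involution on three objects, it fixes one. *)
Lemma turning_descends (V W : finType) (K : {set {set V}}) (L : {set {set W}})
    (p : W -> V) (o : W -> W -> W -> bool) (f : W -> W -> 'Z_3) (w : W) :
  closed_surface K -> closed_surface L -> double_cover K L p ->
  orientation L o -> angular_coordinate o f -> edge_symmetric L f ->
  exists m, turning K m.
Proof.
move=> surfK surfL covp orient fP fsym.
pose m k := opposite_vertex f w k.
have mL k : turning L (m k) := opposite_vertex_turning surfL orient fP fsym w k.
pose d k := deck_twist p (m k).
have dL k : turning L (d k) := deck_twist_turning surfL covp (mL k).
have [a [b t0]] := tri_ex surfL w.
have m_surj z : z \in [set w; a; b] -> exists k, m k [set w; a; b] = z.
  move=> /(triangle_at t0)[x [y tE]]; exists (f x y); rewrite tE.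
  by apply/eqP; rewrite (opposite_vertexP surfL orient fP fsym) // /tri -tE.
have m_inj k k' : m k [set w; a; b] = m k' [set w; a; b] -> k = k'.
  have [/(_ _ t0) zt _] := mL k; have [x [y tE]] := triangle_at t0 zt.
  move: zt; set z := m k [set w; a; b] in tE * => _ e.
  have t1 : tri L z x y by rewrite /tri -tE.
  have eqk j : m j [set w; a; b] = z -> f x y = j.
    move=> ez; apply/eqP.
    by rewrite -(opposite_vertexP surfL orient fP fsym w j t1) -tE -/(m j) ez.
  by rewrite -(eqk k) // (eqk k').
pose g k := odflt 0 [pick j | m j [set w; a; b] == d k [set w; a; b]].
have gP k : {in triangles L, d k =1 m (g k)}.
  apply: (turning_uniq surfL (dL k) (mL _) t0); rewrite /g.
  case: pickP => [j /eqP -> //|none].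
  have [/(_ _ t0)/m_surj[j e] _] := dL k.
  by have := none j; rewrite e eqxx.
have gK : involutive g.
  move=> k; apply: m_inj; rewrite -gP // /d /deck_twist -gP; last first.
    exact: (deck_triangle surfL covp).
  by rewrite /d /deck_twist (deck_imsetK surfL covp) (deckK surfL covp).
have [k gk] := involution_Z3_fixed gK.
apply: (turning_pushforward surfK surfL covp (mL k)) => t tL.
by rewrite [LHS]gP // gk.
Qed.

Theorem theorem1 (V : finType) (S : {set {set V}})
    (W : finType) (Sbar : {set {set W}})
    (o : W -> W -> W -> bool) (v0 : W) :
  closed_surface S -> three_divisible S ->
  orientable_model S Sbar -> orientation Sbar o ->
  (has_two_circuit_decomposition S <-> theta_class Sbar o v0 = 0).
Proof.
move=> surfS divS model; rewrite decomposition_turning //.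
case: model o v0 => [_ o v0 orient|{}W {}Sbar p _ surfL _ covp o v0 orient].
  rewrite theta_class_eq0 //; split=> [[m mS]|[f fP fsym]].
    have [fP fsym] := coordinate_of_turning surfS orient mS.
    by exists (label_of_turning o m).
  exists (opposite_vertex f v0 0).
  exact: (opposite_vertex_turning surfS orient fP fsym v0 0).
have divL := three_divisible_cover covp divS.
rewrite theta_class_eq0 //; split=> [[m mS]|[f fP fsym]].
  have [m' mL] := turning_pullback surfL covp mS.
  have [fP fsym] := coordinate_of_turning surfL orient mL.
  by exists (label_of_turning o m').
exact: turning_descends v0 surfS surfL covp orient fP fsym.
Qed.
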